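(* Let $V$ be the set-valued return function and $V^{k(\epsilon,h)}_{\epsilon,h}$ the final approximate set-valued return function defined in the context. The epigraph of $V^{k(\epsilon,h)}_{\epsilon,h}$ converges in the sense of Painlevé–Kuratowski towards the epigraph of $V$, i.e., $$\mathrm{Graph}(V+\mathbf{R}^p_+)=\lim_{\epsilon\to0^+,\ h/\epsilon\to0^+}\mathrm{Graph}\big(V^{k(\epsilon,h)}_{\epsilon,h}+\mathbf{R}^p_{h,+}\big).$$
   Context: All norms on Euclidean spaces (and their products) are supremum norms; $\mathbf{B}$ is the closed unit ball of the relevant space. Let $0<T<\infty$, $I=[0,T]$, and let $U\subset\mathbf{R}^m$ be nonempty and compact. Let $\mathbf{f}:\mathbf{R}^n\times U\to\mathbf{R}^n$ and $\mathbf{L}:\mathbf{R}^n\times U\to\mathbf{R}^p$ be continuous, bounded respectively by $M_{\mathbf{f}}>0$ and $M_{\mathbf{L}}\ge0$, and Lipschitz in $\mathbf{x}$ uniformly in $\mathbf{u}\in U$ with respective constants $K_{\mathbf{f}}>0$ and $K_{\mathbf{L}}\ge0$. For nonempty $S\subset\mathbf{R}^p$, $\mathcal{E}(S)$ is the set of Pareto optimal elements of $S$: those $\mathbf{y}_1\in S$ for which there is no $\mathbf{y}_2\in S$, $\mathbf{y}_2\neq\mathbf{y}_1$, with $\mathbf{y}_1\in\mathbf{y}_2+\mathbf{R}^p_+$. Set-valued return function: $\mathcal{U}$ is the set of bounded Lebesgue measurable functions $\mathbf{u}(\cdot):I\to U$; $s\mapsto\mathbf{x}(s;t,\mathbf{x},\mathbf{u}(\cdot))$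 is the unique solution of $\dot{\mathbf{x}}(s)=\mathbf{f}(\mathbf{x}(s),\mathbf{u}(s))$, $t\le s\le T$, $\mathbf{x}(t)=\mathbf{x}$; $Y(t,\mathbf{x})=\{\int_t^T\mathbf{L}(\mathbf{x}(s;t,\mathbf{x},\mathbf{u}(\cdot)),\mathbf{u}(s))\,\mathrm{d}s:\mathbf{u}(\cdot)\in\mathcal{U}\}$; and $V(t,\mathbf{x})=\mathcal{E}(\mathrm{cl}(Y(t,\mathbf{x})))$ for $(t,\mathbf{x})\in I\times\mathbf{R}^n$. The epigraph of $V$ is $\mathrm{Graph}(V+\mathbf{R}^p_+)=\{(t,\mathbf{x},\mathbf{z}):t\in I,\ \mathbf{x}\in\mathbf{R}^n,\ \mathbf{z}\in V(t,\mathbf{x})+\mathbf{R}^p_+\}$; likewise the epigraph of a map $W$ from $I_h\times\mathbf{R}^n_h$ to $\mathbf{R}^p_h$ is $\mathrm{Graph}(W+\mathbf{R}^p_{h,+})$. Put $\mathrm{FL}^+(\mathbf{x})=\overline{\mathrm{co}}\big(\bigcup_{\mathbf{u}\in U}\{(\mathbf{f}(\mathbf{x},\mathbf{u}),\mathbf{L}(\mathbf{x},\mathbf{u}))\}\big)$ (closure of the convex hull), $M=\max\{1,M_{\mathbf{f}},M_{\mathbf{L}}\}$, $K=\max\{K_{\mathbf{f}},K_{\mathbf{L}}\}$. Discretization: $\epsilon,h>0$; $\mathbf{R}_h=h\mathbf{Z}$, with product lattices $\mathbf{R}_h^n$, $\mathbf{R}_h^p$; $\mathbf{R}^p_{h,+}=\mathbf{R}^p_h\cap\mathbf{R}^p_+$;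 $\alpha_{\epsilon,h}=2h+\epsilon hK+\epsilon^2KM$; $I_h=(I+[-h,h])\cap\mathbf{R}_h$; $\mathbf{1}=(1,\dots,1)\in\mathbf{R}^p$. Fix $\overline{M}_{\mathbf{L}}>M_{\mathbf{L}}$ and let $\mathcal{H}=\{(t,\mathbf{x},\mathbf{z}):t\in[0,T],\ \mathbf{x}\in\mathbf{R}^n,\ \mathbf{z}\in\{-(T-t)\overline{M}_{\mathbf{L}}\mathbf{1}\}+\mathbf{R}^p_+\}$ and $\mathcal{H}_h=(\mathcal{H}+h\mathbf{B})\cap(\mathbf{R}_h\times\mathbf{R}^n_h\times\mathbf{R}^p_h)$. Approximate set-valued return functions: $V^0_{\epsilon,h}$ is a set-valued map from $I_h\times\mathbf{R}^n_h$ to $\mathbf{R}^p_h$ with finite values such that $\mathrm{Graph}(V^0_{\epsilon,h}+\mathbf{R}^p_{h,+})=\mathcal{H}_h$. For $k\ge0$ and $(t_h,\mathbf{x}_h)\in I_h\times\mathbf{R}^n_h$: if $t_h<T-M\epsilon-h$, $$V^{k+1}_{\epsilon,h}(t_h,\mathbf{x}_h)=\mathcal{E}\Big(\bigcup_{(\mathbf{f},\mathbf{l})\in\mathrm{FL}^+(\mathbf{x}_h)}\Big[(\epsilon\mathbf{l}+\alpha_{\epsilon,h}\mathbf{B})\cap\mathbf{R}^p_h+V^k_{\epsilon,h}\big((t_h+\epsilon+[-2h,2h])\cap\mathbf{R}_h,\ (\mathbf{x}_h+\epsilon\mathbf{f}+\alpha_{\epsilon,h}\mathbf{B})\cap\mathbf{R}^n_h\big)\Big]\Big),$$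 where $V^k_{\epsilon,h}(A,B)=\bigcup_{a\in A,b\in B}V^k_{\epsilon,h}(a,b)$; otherwise $V^{k+1}_{\epsilon,h}(t_h,\mathbf{x}_h)=V^k_{\epsilon,h}(t_h,\mathbf{x}_h)$. The sequence $(V^k_{\epsilon,h})_k$ is finite, i.e. constant from some index on; $k(\epsilon,h)$ denotes its last index, so that $V^k_{\epsilon,h}=V^{k(\epsilon,h)}_{\epsilon,h}$ for all $k\ge k(\epsilon,h)$. Standing assumptions on the pairs $(\epsilon,h)$ considered: $T$ is a multiple of $h$; $\epsilon-2h>2h$; for all $(t_h,\mathbf{x}_h)\in I_h\times\mathbf{R}^n_h$ with $t_h\ge h$, $V^0_{\epsilon,h}(t_h,\mathbf{x}_h)=\{(-(T+h-t_h)\overline{M}_{\mathbf{L}}-h)\mathbf{1}\}$; and $\epsilon M_{\mathbf{L}}+\alpha_{\epsilon,h}\le(\epsilon-2h)\overline{M}_{\mathbf{L}}$. Painlevé–Kuratowski convergence: $D=\lim D_{\epsilon,h}$ as $\epsilon\to0^+$, $h/\epsilon\to0^+$ means that $D$ equals both the lower limit (the points $y$ with $\mathrm{dist}(y,D_{\epsilon,h})\to0$) and the upper limit (the points $y$ with $\liminf\mathrm{dist}(y,D_{\epsilon,h})=0$), the limits being taken over the pairs $(\epsilon,h)$ considered. *)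

(* Defs.v *)
From HB Require Import structures.
From mathcomp Require Import all_boot all_order all_algebra.
From mathcomp Require Import all_classical all_reals all_analysis.

Set Implicit Arguments.
Unset Strict Implicit.
Unset Printing Implicit Defensive.

Import Order.TTheory GRing.Theory Num.Theory.
Import numFieldNormedType.Exports.

Local Open Scope classical_set_scope.
Local Open Scope ring_scope.

(* The norm of 'rV[R]_n and of products is the maximum norm. *)

Definition msum (V : zmodType) (A B : set V) : set V :=
  [set a + b | a in A & b in B].

Section Pareto.
Context {R : realType} {p : nat}.

Definition orthant : set 'rV[R]_p := [set z | forall j, 0 <= z ord0 j].

Definition pareto (S : set 'rV[R]_p) : set 'rV[R]_p :=
  [set y1 | S y1 /\
    ~ exists y2, [/\ S y2, y2 <> y1 & msum [set y2] orthant y1]].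

End Pareto.

Section Lattice.
Context {R : realType}.

Definition lattice (h : R) : set R := range (fun k : int => k%:~R * h).

Definition vlattice (d : nat) (h : R) : set 'rV[R]_d :=
  [set v | forall j, lattice h (v ord0 j)].

End Lattice.
Arguments vlattice {R} d h.

Section Epigraph.
Context {R : realType} {n p : nat}.

(* Graph(W + C) for a set-valued map W with domain D x X. *)
Definition epigraph (D : set R) (X : set 'rV[R]_n) (C : set 'rV[R]_p)
    (W : R -> 'rV[R]_n -> set 'rV[R]_p) : set (R * 'rV[R]_n * 'rV[R]_p) :=
  [set q | [/\ D q.1.1, X q.1.2 & msum (W q.1.1 q.1.2) C q.2]].

End Epigraph.

Section ReturnFunction.
Context {R : realType} {n m p : nat}.
Variables (T : R) (U : set 'rV[R]_m).
Variables (f : 'rV[R]_n -> 'rV[R]_m -> 'rV[R]_n)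
          (L : 'rV[R]_n -> 'rV[R]_m -> 'rV[R]_p).

(* R with the sigma-algebra of Lebesgue (Caratheodory) measurable sets. *)
Definition lebesgueType : measurableType _ :=
  caratheodory_type (@wlength R idfun)^*%mu.

(* Only the restriction of u to [0, T] is relevant; 'rV_m carries its Borel
   sigma-algebra. *)
Definition controls : set (R -> 'rV[R]_m) :=
  [set u | [/\ (forall s, `[0, T]%classic s -> U (u s)),
    [bounded u s | s in `[0, T]] &
    @measurable_fun _ _ lebesgueType (g_sigma_algebraType (@open 'rV[R]_m))
      `[0, T] u]].

Definition abs_continuous (V : normedModType R) (a b : R) (g : R -> V) :=
  forall e : R, 0 < e -> exists2 d : R, 0 < d &
    forall (N : nat) (l r : 'I_N -> R),
      (forall i, [/\ a <= l i, l i <= r i & r i <= b]) ->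
      trivIset [set: 'I_N] (fun i => `]l i, r i[%classic) ->
      \sum_i (r i - l i) < d ->
      \sum_i `|g (r i) - g (l i)| < e.

(* Caratheodory solutions on [t, T]. The two-sided derivative does not look
   outside [t, T]: the end points form a null set. *)
Definition solution (t : R) (x : 'rV[R]_n) (u : R -> 'rV[R]_m)
    (xi : R -> 'rV[R]_n) :=
  [/\ abs_continuous t T xi, xi t = x &
    \forall s \ae (@lebesgue_measure R), `[t, T]%classic s ->
      is_derive s (1 : R) xi (f (xi s) (u s))].

Definition Yset (t : R) (x : 'rV[R]_n) : set 'rV[R]_p :=
  [set y | exists u xi, [/\ controls u, solution t x u xi &
    y = \row_j \int[@completed_lebesgue_measure R]_(s in `[t, T])
                 (L (xi s) (u s) ord0 j)]].

Definition return_map (t : R) (x : 'rV[R]_n) : set 'rV[R]_p :=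
  pareto (closure (Yset t x)).

Definition FLplus (x : 'rV[R]_n) : set ('rV[R]_n * 'rV[R]_p) :=
  closure (smallest (@convex_set R ('rV[R]_n * 'rV[R]_p)%type)
    [set (f x u, L x u) | u in U]).

End ReturnFunction.

Section Approximation.
Context {R : realType} {n m p : nat}.
Variables (T : R) (U : set 'rV[R]_m).
Variables (f : 'rV[R]_n -> 'rV[R]_m -> 'rV[R]_n)
          (L : 'rV[R]_n -> 'rV[R]_m -> 'rV[R]_p).
Variables (Mf ML Kf KL MbarL : R).

Let M := Num.max 1 (Num.max Mf ML).
Let K := Num.max Kf KL.

Definition alpha (eps h : R) : R :=
  2 * h + eps * h * K + eps ^+ 2 * K * M.

Definition timegrid (h : R) : set R :=
  msum `[0, T] `[- h, h] `&` lattice h.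

Definition Hset : set (R * 'rV[R]_n * 'rV[R]_p) :=
  [set q | `[0, T]%classic q.1.1 /\
    msum [set const_mx (- ((T - q.1.1) * MbarL))] orthant q.2].

Definition Hgrid (h : R) : set (R * 'rV[R]_n * 'rV[R]_p) :=
  msum Hset (closed_ball 0 h) `&`
  [set q | [/\ lattice h q.1.1, vlattice n h q.1.2 & vlattice p h q.2]].

Definition grid_epigraph (h : R) (W : R -> 'rV[R]_n -> set 'rV[R]_p) :=
  epigraph (timegrid h) (vlattice n h) (vlattice p h `&` orthant) W.

Definition initial_map (h : R) (W : R -> 'rV[R]_n -> set 'rV[R]_p) :=
  (forall t x, timegrid h t -> vlattice n h x ->
     W t x `<=` vlattice p h /\ finite_set (W t x)) /\
  grid_epigraph h W = Hgrid h.

Definition step (eps h : R) (W : R -> 'rV[R]_n -> set 'rV[R]_p)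
    (t : R) (x : 'rV[R]_n) : set 'rV[R]_p :=
  if t < T - M * eps - h then
    pareto (\bigcup_(q in FLplus U f L x)
      msum (closed_ball (eps *: q.2) (alpha eps h) `&` vlattice p h)
        (\bigcup_(s in `[t + eps - 2 * h, t + eps + 2 * h] `&` lattice h)
         \bigcup_(y in closed_ball (x + eps *: q.1) (alpha eps h) `&`
                       vlattice n h) W s y))
  else W t x.

Variable V0 : R -> R -> R -> 'rV[R]_n -> set 'rV[R]_p.

Definition approx (eps h : R) (k : nat) : R -> 'rV[R]_n -> set 'rV[R]_p :=
  iter k (step eps h) (V0 eps h).

Definition stable_from (eps h : R) (N : nat) :=
  forall k, (N <= k)%N -> forall t x, timegrid h t -> vlattice n h x ->
    approx eps h k t x = approx eps h N t x.

Definition last_index (eps h : R) : nat :=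
  xget 0%N [set N | stable_from eps h N /\
                    forall N', stable_from eps h N' -> (N <= N')%N].

Definition final_approx (eps h : R) : R -> 'rV[R]_n -> set 'rV[R]_p :=
  approx eps h (last_index eps h).

Definition considered : set (R * R) :=
  [set q | let eps := q.1 in let h := q.2 in
    [/\ 0 < eps /\ 0 < h, lattice h T, 2 * h < eps - 2 * h,
      (forall t x, timegrid h t -> vlattice n h x -> h <= t ->
         V0 eps h t x = [set const_mx (- ((T + h - t) * MbarL) - h)]) &
      eps * ML + alpha eps h <= (eps - 2 * h) * MbarL]].

End Approximation.

Section PainleveKuratowski.
Context {R : realType}.

(* eps -> 0+ and h / eps -> 0+, for the pairs q = (eps, h). *)
Definition fine_pairs : set_system (R * R) :=
  filter_from [set d : R | 0 < d]
    (fun d => [set q | 0 < q.1 < d /\ 0 < q.2 / q.1 < d]).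

(* Limits over the pairs in P are meaningful only if P has arbitrarily fine
   pairs: otherwise the filter within P fine_pairs is improper. *)
Definition arbitrarily_fine (P : set (R * R)) :=
  forall d : R, 0 < d ->
    exists2 q, P q & 0 < q.1 < d /\ 0 < q.2 / q.1 < d.

Context {X : pseudoMetricType R}.
Variables (F : set_system (R * R)) (D : R * R -> set X).

(* edist_inf A y is the distance from y to A, and +oo if A is empty. *)
Definition lower_limit : set X :=
  [set y | (fun q => edist_inf (D q) y) @ F --> 0%E].

Definition upper_limit : set X :=
  [set y | limf_einf (fun q => edist_inf (D q) y) F = 0%E].

Definition PK_limit (A : set X) := A = lower_limit /\ A = upper_limit.

End PainleveKuratowski.

(* Main.v *)
Require Import Defs.
From HB Require Import structures.
From mathcomp Require Import all_boot all_order all_algebra.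
From mathcomp Require Import all_classical all_reals all_analysis.
From mathcomp Require Import measurable_realfun ring lra.

(** Why the convergence holds.

Pareto optimality disappears on both sides once the ordering cone is added.
The closure of Y(t, x) is compact, so every point of it dominates a Pareto
element of it ([pareto_compact_dominates]) and V + R^p_+ is the closure of Y
plus R^p_+.  A set of lattice points bounded below has the same property
([pareto_lattice_dominates]), so the epigraph of the final approximate map W
consists of the costs of all chains of grid steps, raised by nonnegative lattice
vectors.  It remains to compare the costs of true trajectories with the costs
of chains.  Each step of the scheme raises the grid time by at least
eps - 2 h > 0; hence the iteration stabilizes ([final_stable]), W is a fixed
point of the step ([final_step]), and facts about W are proved by induction
backward in grid time ([grid_time_ind]).

From true trajectories to chains.  Over a step of length eps the mean of the pair
(velocity, running cost) of a trajectory is, up to any slack, a convex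
combination of the pairs taken along the trajectory ([mean_value]), hence it is
close to the convex hull of the pairs at a neighbouring grid point
([Yset_split]).  The radius alpha is large enough to absorb this error together
with the rounding to the grid, so every lattice point within h / 2 of the true
epigraph is in the approximate epigraph ([grid_epigraph_contains_rounding]).
As h tends to 0 this puts the true epigraph into the lower limit.

From chains to true trajectories.  An element of the closed convex hull can be
followed during one step, up to a controlled error, by switching between
finitely many constant controls ([steerable_FLplus]): being followable is stable
under convex combination, because the two parts of the combination can be
executed one after the other.  The errors made in the successive steps add up as
in Gronwall's inequality ([Yset_shadows_grid]) and tend to 0 with eps and h / eps.
So a point of the upper limit is approximately above attainable costs, and by
compactness it is above a point of the closure of Y
([closure_attains_approximate_bound]).

The analytic input is light.  Trajectories for constant controls come from Picard
iteration on short intervals ([picard]) and are glued in front of existing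
ones ([prepend_constant_control]).  Solutions for arbitrary measurable controls
enter only through [mean_value], which treats the absolutely continuous
trajectory and the integral of the measurable running cost at once: it
compares both with one and the same Riemann sum, by means of a gauge that
controls the integral (Perron's major functions, [major_function]) and the
exceptional null set (absolute continuity). *)

Set Implicit Arguments.
Unset Strict Implicit.
Unset Printing Implicit Defensive.

Import Order.TTheory GRing.Theory Num.Theory.
Import numFieldNormedType.Exports.
Local Open Scope classical_set_scope.
Local Open Scope ring_scope.

(** * Tagged partitions and major functions *)

(** Cousin's lemma, by a supremum argument.  The relation is abstract so that tagged
partitions need not appear as objects: additivity plays the part of their
concatenation. *)
Lemma cousin (R : realType) (Q : R -> R -> Prop) (a b : R) : a <= b ->
  (forall l m r, a <= l -> l <= m -> m <= r -> r <= b -> Q l m -> Q m r -> Q l r) ->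
  (forall s, a <= s -> s <= b -> exists2 d, 0 < d &
     forall l r, a <= l -> l <= s -> s <= r -> r <= b ->
       s - d < l -> r < s + d -> Q l r) ->
  Q a b.
Proof.
move=> ab Qcat Qloc.
pose S := [set x | [/\ a <= x, x <= b & Q a x]].
have Sa : S a.
  split => //; have [d d0 Qd] := Qloc a (lexx a) ab.
  by apply: Qd => //; rewrite ?ltrDl// ltrBlDr ltrDl.
have S0 : S !=set0 by exists a.
have Sb : has_ubound S by exists b => x [].
have Sup : has_sup S by split.
set c := sup S.
have ac : a <= c by apply: ub_le_sup.
have cb : c <= b by apply: ge_sup => // x [].
have [d d0 Qd] := Qloc c ac cb.
have [x [ax xb Qx] xc] := sup_adherent d0 Sup.
have xlec : x <= c by apply: ub_le_sup.
set r := Num.min b (c + d / 2).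
have d2 : 0 < d / 2 by rewrite divr_gt0.
have cr : c <= r by rewrite /r le_min cb lerDl ltW.
have rb : r <= b by rewrite /r ge_min lexx.
have rd : r < c + d.
  rewrite /r (le_lt_trans (_ : _ <= c + d / 2))//; first by rewrite ge_min lexx orbT.
  by rewrite ltrD2l ltr_pdivrMr// mulr2n mulrDr mulr1 ltrDl.
have Qr : Q a r by apply: (Qcat a x r) => //; [exact: le_trans cr|exact: Qd].
have rc : r <= c by apply: ub_le_sup => //; split => //; apply: le_trans cr.
have -> // : b = r.
move: rc; rewrite {1}/r ge_min => /orP[bc|].
  by apply/eqP; rewrite eq_le rb andbT (le_trans bc).
by rewrite gerDl leNgt d2.
Qed.

(** Rounding y down to a multiple of d, written as a count of the levels below y; this
turns sums over superlevel sets into approximations of a function. *)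
Lemma staircase (R : realType) (d y : R) (N : nat) :
  0 < d -> 0 <= y -> y <= N%:R * d ->
  y - d <= \sum_(k < N) ((k.+1%:R * d <= y)%R%:R * d) /\
  \sum_(k < N) ((k.+1%:R * d <= y)%R%:R * d) <= y.
Proof.
move=> d0 y0; elim: N => [|N IH] yN.
  by rewrite big_ord0; move: yN; rewrite mul0r => yN; split; lra.
rewrite big_ord_recr /=; have [yN'|Ny] := leP y (N%:R * d).
  have -> : (N.+1%:R * d <= y) = false.
    by apply/negbTE; rewrite -ltNge -natr1 mulrDl mul1r; lra.
  by rewrite mul0r addr0; exact: IH.
have -> : \sum_(k < N) ((k.+1%:R * d <= y)%R%:R * d) = N%:R * d.
  transitivity (\sum_(k < N) d); last first.
    by rewrite sumr_const card_ord mulr_natl.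
  apply: eq_bigr => k _; suff -> : k.+1%:R * d <= y by rewrite mul1r.
  by apply: ltW; apply: le_lt_trans Ny; rewrite ler_pM2r// ler_nat.
case: (leP (N.+1%:R * d) y) yN => /= [h1 h2|h1 h2];
  rewrite ?mul1r ?mul0r; rewrite -natr1 mulrDl mul1r in h1 h2; split; lra.
Qed.

Lemma bounded_integrable (d : measure_display) (X : measurableType d) (R : realType)
  (mu : {measure set X -> \bar R}) (D : set X) (G : X -> R) (M : R) :
  measurable D -> (mu D < +oo)%E -> measurable_fun D G ->
  (forall s, D s -> `|G s| <= M) -> mu.-integrable D (EFin \o G).
Proof.
move=> mD Doo mG GM; apply: measurable_bounded_integrable => //.
exists M; split; first exact: num_real.
by move=> N MN s Ds /=; apply: le_trans (GM s Ds) (ltW MN).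
Qed.

(** Lower half of the layer-cake formula with levels spaced by e; the level
sets enter only through their measures, so they can be replaced by larger open sets. *)
Lemma layer_cake_le (d : measure_display) (X : measurableType d) (R : realType)
  (mu : {measure set X -> \bar R}) (D : set X) (G : X -> R) (e : R) (N : nat) :
  measurable D -> (mu D < +oo)%E -> measurable_fun D G -> 0 < e ->
  (forall s, D s -> 0 <= G s <= N%:R * e) ->
  \sum_(k < N) e * fine (mu (D `&` [set s | k.+1%:R * e <= G s])) <=
    \int[mu]_(s in D) G s.
Proof.
move=> mD Doo mG e0 GN.
pose E k := D `&` [set s | k.+1%:R * e <= G s].
have mE k : measurable (E k).
  have := mG mD _ (measurable_itv `[k.+1%:R * e, +oo[).
  congr measurable; apply/seteqP; split => s /=; rewrite in_itv/= andbT;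
    by case.
have Efin k : mu (E k) \is a fin_num.
  rewrite ge0_fin_numE//; apply: le_lt_trans Doo; apply: le_measure; rewrite ?inE//.
  exact: subIsetl.
have iG : mu.-integrable D (EFin \o G).
  apply: (@bounded_integrable _ _ _ _ _ _ (N%:R * e)) => // s Ds.
  by have /andP[G0 GN'] := GN s Ds; rewrite ger0_norm.
have Gfin := integrable_fin_num mD iG.
rewrite /Rintegral -lee_fin fineK//.
have -> : (\sum_(k < N) e * fine (mu (E k)))%:E =
    (\int[mu]_(s in D) (\sum_(k < N) (e%:E * (\1_(E k) s)%:E)))%E.
  rewrite ge0_integral_sum//; last 2 first.
  - move=> k; apply/measurable_EFinP; apply: measurable_funM => //.
  - by move=> k s _; rewrite mule_ge0// ?lee_fin// ltW.
  rewrite -sumEFin; apply: eq_bigr => k _.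
  rewrite (ge0_integralZl_EFin mu mD)//; [|exact/measurable_EFinP|exact: ltW].
  rewrite integral_indic// EFinM fineK//; congr (_ * mu _)%E.
  by rewrite setIC; apply/esym/setIidPr; apply: subIsetl.
apply: ge0_le_integral => //.
- move=> s _; apply: sume_ge0 => k _; by rewrite mule_ge0// ?lee_fin// ltW.
- apply: emeasurable_sum => k; apply/measurable_EFinP; exact: measurable_funM.
- exact/measurable_EFinP.
move=> s Ds; under eq_bigr do rewrite -EFinM.
rewrite sumEFin lee_fin.
have /andP[G0 GN'] := GN s Ds.
have [_ le2] := @staircase R e (G s) N e0 G0 GN'.
apply: le_trans le2; apply: ler_sum => k _; rewrite mulrC ler_pM2r// indicE.
case: (boolP (s \in E k)) => [|_]; last by rewrite ler0n.
by rewrite inE => -[_ /= ->].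
Qed.

(** [open_length] is additive in the interval and agrees with the length of an interval
contained in the open set.  These two facts make it behave like an increment,
so that sums over the pieces of a partition never have to be formed. *)
Section OpenLength.
Context {R : realType}.

Definition open_length (O : set R) (l r : R) : R :=
  fine (@lebesgue_measure R (O `&` `]l, r])).

Lemma open_length_fin (O : set R) l r : open O ->
  (@lebesgue_measure R (O `&` `]l, r])) \is a fin_num.
Proof.
move=> oO; rewrite ge0_fin_numE//.
have mO : measurable O by exact: open_measurable.
apply: (@le_lt_trans _ _ (@lebesgue_measure R `]l, r])).
  by apply: le_measure; rewrite ?inE//=; exact: measurableI.
by rewrite lebesgue_measure_itv/=; case: ifP => _; rewrite ?ltry// -EFinB ltry.
Qed.

Lemma open_length_ge0 (O : set R) l r : 0 <= open_length O l r.
Proof. exact: fine_ge0. Qed.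

Lemma open_lengthxx (O : set R) l : open_length O l l = 0.
Proof. by rewrite /open_length set_itvoc0 setI0 measure0. Qed.

Lemma open_length_cat (O : set R) l m r : open O -> l <= m -> m <= r ->
  open_length O l r = open_length O l m + open_length O m r.
Proof.
move=> oO lm mr; rewrite /open_length -fineD; [|exact: open_length_fin..].
have mO : measurable O by exact: open_measurable.
rewrite -measureU; first last.
- apply/seteqP; split => // x [[_ /= +] [_ /=]]; rewrite !in_itv/=.
  by move=> /andP[_ xm] /andP[]; rewrite ltNge xm.
- exact: measurableI.
- exact: measurableI.
rewrite -setIUr; congr (fine (lebesgue_measure (_ `&` _))).
apply/seteqP; split => x /=; rewrite !in_itv/=.
  move=> /andP[lx xr]; have [xm|mx] := leP x m; [left|right]; exact/andP.
case=> /andP[h1 h2]; apply/andP; split => //.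
  exact: le_trans mr.
exact: le_lt_trans h1.
Qed.

Lemma open_length_full (O : set R) l r : l <= r -> `]l, r] `<=` O ->
  open_length O l r = r - l.
Proof.
move=> lr lrO; rewrite /open_length (_ : O `&` `]l, r] = `]l, r]%classic); last exact/setIidPr.
rewrite lebesgue_measure_itv/= lte_fin; move: lr.
rewrite le_eqVlt => /orP[/eqP->|lr]; first by rewrite ltxx subrr.
by rewrite lr -EFinB.
Qed.

Lemma open_length_le (O : set R) l r (c : R) : open O ->
  (@lebesgue_measure R O <= c%:E)%E -> open_length O l r <= c.
Proof.
move=> oO Oc; rewrite -lee_fin fineK; last exact: open_length_fin.
apply: le_trans Oc; have mO : measurable O by exact: open_measurable.
by apply: le_measure; rewrite ?inE//=; exact: measurableI.
Qed.

Lemma open_itv_nbhs (O : set R) s : open O -> O s ->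
  \forall d \near 0^'+, forall l r, s - d < l -> r < s + d -> `]l, r] `<=` O.
Proof.
move=> oO Os; have /nbhs_ballP[d /= d0 dO] : nbhs s O by exact: open_nbhs_nbhs.
near=> e => l r sl rs x /=; rewrite in_itv/= => /andP[lx xr].
apply: dO; rewrite /ball/=.
have ed : e <= d by near: e; exact: nbhs_right_le.
by rewrite ltr_norml; apply/andP; split; lra.
Unshelve. all: by end_near. Qed.

End OpenLength.

Lemma completed_measurable_itv (R : realType) (i : interval R) :
  @measurable _ (@lebesgueType R) [set` i].
Proof. by apply: sub_caratheodory; exact: measurable_itv. Qed.

Lemma completed_measure_itv (R : realType) (a b : R) : a <= b ->
  @completed_lebesgue_measure R `[a, b] = (b - a)%:E.
Proof.
move=> ab; transitivity (@lebesgue_measure R `[a, b]) => //.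
rewrite lebesgue_measure_itv/= lte_fin; move: ab.
rewrite le_eqVlt => /orP[/eqP->|ab]; first by rewrite ltxx subrr.
by rewrite ab -EFinB.
Qed.

(** Perron's upper estimate of the integral: the increments of phi majorize the terms
of every Riemann sum that is fine enough, while the total increment exceeds the
integral by at most e.  Round G + M down to multiples of d; each superlevel set is covered
by an open set of almost the same measure, and phi adds up the lengths of these
covers.  Near a point of a superlevel set the interval lies inside the cover, so
it contributes its full length. *)
Lemma major_function (R : realType) (G : R -> R) (a b M e : R) :
  a <= b -> 0 < e -> @measurable_fun _ _ (@lebesgueType R) _ `[a, b] G ->
  (forall s, a <= s <= b -> `|G s| <= M) ->
  exists2 phi : R -> R,
    phi b - phi a <= \int[@completed_lebesgue_measure R]_(s in `[a, b]) G s + e &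
    forall s, a <= s <= b -> \forall d \near 0^'+,
      forall l r, a <= l -> l <= s -> s <= r -> r <= b -> s - d < l -> r < s + d ->
        G s * (r - l) <= phi r - phi l.
Proof.
move=> ab e0 mG GM.
pose mu := @completed_lebesgue_measure R.
pose D : set R := `[a, b]%classic.
have M0 : 0 <= M by rewrite (le_trans _ (GM a _))// lexx.
pose d := e / (2 * (b - a) + 2).
have den0 : 0 < 2 * (b - a) + 2 by lra.
have d0 : 0 < d by rewrite divr_gt0.
have dba : d * (b - a) <= e / 2.
  rewrite /d mulrAC ler_pdivrMr// [leRHS]mulrC mulrA ler_pdivlMr//.
  rewrite mulrAC mulrC -mulrA ler_pM2l//; lra.
pose N := (Num.truncn (2 * M / d)).+1.
have MN : 2 * M <= N%:R * d.
  by rewrite -ler_pdivrMr// ltW// truncnS_gt.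
pose y s := G s + M.
have y0N s : a <= s <= b -> 0 <= y s <= N%:R * d.
  by move=> /GM; rewrite ler_norml /y => /andP[h1 h2]; apply/andP; split; lra.
pose E k : set R := D `&` [set s | k.+1%:R * d <= y s].
pose e1 := e / 2 / (N%:R * d + 1).
have Nd0 : 0 <= N%:R * d by rewrite mulr_ge0// ltW.
have e10 : 0 < e1 by rewrite !divr_gt0//; lra.
have Nde1 : N%:R * d * e1 <= e / 2.
  rewrite /e1 mulrA ler_pdivrMr; last lra.
  by rewrite mulrDr mulr1 mulrC lerDl; lra.
have mD : @measurable _ (@lebesgueType R) D by exact: completed_measurable_itv.
have muD : mu D = (b - a)%:E by exact: completed_measure_itv.
have Doo : (mu D < +oo)%E by rewrite muD ltry.
have my : @measurable_fun _ _ (@lebesgueType R) _ D y.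
  by apply: measurable_funD => //; exact: measurable_cst.
have mE k : @measurable _ (@lebesgueType R) (E k).
  have := my mD _ (measurable_itv `[k.+1%:R * d, +oo[).
  congr measurable; apply/seteqP; split => s /=; rewrite in_itv/= andbT;
    by case.
have Efin k : mu (E k) \is a fin_num.
  rewrite ge0_fin_numE//; apply: le_lt_trans Doo; apply: le_measure; rewrite ?inE//.
  exact: subIsetl.
have /choice [ O OP] : forall k, exists O : set R, [/\ open O, E k `<=` O &
    (@lebesgue_measure R O <= (fine (mu (E k)) + e1)%:E)%E].
  move=> k; have [ O [oO EO Oe]] := outer_measure_open_le (E k) e10.
  by exists O; split => //; rewrite EFinD fineK.
have oO k : open (O k) by have [] := OP k.
exists (fun x => (d - M) * x + \sum_(k < N) d * open_length (O k) a x).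
  under [X in _ - (_ + X)]eq_bigr do rewrite open_lengthxx mulr0.
  rewrite big1_eq addr0.
  have := @layer_cake_le _ _ _ mu D y d N mD Doo my d0.
  have -> : \int[mu]_(s in D) y s = \int[mu]_(s in D) G s + M * (b - a).
    rewrite RintegralD//.
    - congr (_ + _); transitivity (M * fine (mu D)); last by rewrite muD.
      exact: Rintegral_cst.
    - by apply: (@bounded_integrable _ _ _ _ _ _ M).
    - apply: (@bounded_integrable _ _ _ _ _ _ M) => //.
      by move=> s _; rewrite ger0_norm.
  move=> /(_ (fun s Ds => y0N s Ds)) lay.
  have : \sum_(k < N) d * open_length (O k) a b <=
         \sum_(k < N) d * (fine (mu (E k)) + e1).
    apply: ler_sum => k _; rewrite ler_pM2l//; apply: open_length_le => //.
    by have [] := OP k.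
  under [X in _ <= X -> _]eq_bigr do rewrite mulrDr.
  rewrite big_split/= sumr_const card_ord -[X in _ <= _ + X -> _]mulr_natl mulrA.
  rewrite -/mu -/D; set I := \int[mu]_(s in D) G s; move: lay; rewrite -/I => lay.
  rewrite /E in lay * => lay2.
  lra.
move=> s sab.
(* Only finitely many covers are involved, so one radius serves them all. *)
have [stair _] := @staircase R d (y s) N d0 (proj1 (andP (y0N s sab))) (proj2 (andP (y0N s sab))).
have near_O : \forall dl \near 0^'+, forall k : 'I_N, E k s ->
    forall l r, s - dl < l -> r < s + dl -> `]l, r] `<=` O k.
  apply: filter_forall => k; have [Es|nEs] := pselect (E k s); last first.
    by apply: nearW => ? /nEs.
  have [_ /(_ _ Es) Os _] := OP k.
  by apply: filterS (open_itv_nbhs (oO k) Os) => dl h _.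
near=> dl => l r al ls sr rb sl rs.
have lr : l <= r by exact: le_trans sr.
have dlO : forall k : 'I_N, E k s ->
    forall l r, s - dl < l -> r < s + dl -> `]l, r] `<=` O k by near: dl.
have -> : (d - M) * r + \sum_(k < N) d * open_length (O k) a r -
   ((d - M) * l + \sum_(k < N) d * open_length (O k) a l) =
   (d - M) * (r - l) + \sum_(k < N) d * open_length (O k) l r.
  under eq_bigr do rewrite (open_length_cat (oO _) al lr) mulrDr.
  by rewrite big_split/=; ring.
have : \sum_(k < N) ((k.+1%:R * d <= y s)%R%:R * d) * (r - l) <=
       \sum_(k < N) d * open_length (O k) l r.
  apply: ler_sum => k _; case: (boolP (k.+1%:R * d <= y s)) => /= h.
    rewrite mul1r ler_pM2l// open_length_full//; apply: (dlO k) => //.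
  rewrite !mul0r; apply: mulr_ge0; [exact: ltW|exact: open_length_ge0].
rewrite -mulr_suml; have := ler_wpM2r (_ : 0 <= r - l) stair.
rewrite subr_ge0 => /(_ lr); rewrite /y; lra.
Unshelve. all: by end_near. Qed.

(** * Mean values of a trajectory and its running cost *)

Lemma subrACA (V : zmodType) (x y a b : V) : (x - a) - (y - b) = (x - y) - (a - b).
Proof. by rewrite !opprD !opprK addrACA. Qed.

Section RowNorm.
Context {R : realType} {n : nat}.
Implicit Types v : 'rV[R]_n.

Lemma row_norm_coord v j : `|v ord0 j| <= `|v|.
Proof.
by rewrite [leRHS]/Num.Def.normr/= mx_normrE; exact: (le_bigmax _ _ (ord0, j)).
Qed.

Lemma row_norm_le v (e : R) : 0 <= e -> (forall j, `|v ord0 j| <= e) -> `|v| <= e.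
Proof.
move=> e0 ve; rewrite /Num.Def.normr/= mx_normrE; apply: bigmax_le => // -[i j] _ /=.
by rewrite (ord1 i).
Qed.

End RowNorm.

(** Increasing lists of nonoverlapping intervals between two end points.  They carry
the part of a partition that meets an exceptional set, and concatenation mirrors the
additivity used in Cousin's lemma. *)
Section Chain.
Context {R : realType}.

Fixpoint chain (l : R) (s : seq (R * R)) (r : R) : Prop :=
  if s is (x, y) :: s' then [/\ l <= x, x <= y & chain y s' r] else l <= r.

Lemma chain_le l s r : chain l s r -> l <= r.
Proof.
elim: s l => [//|[x y] s IH] l [/= lx xy /IH yr].
exact: le_trans lx (le_trans xy yr).
Qed.

Lemma chain_cat l s m s' r : chain l s m -> chain m s' r -> chain l (s ++ s') r.
Proof.
elim: s l => [|[x y] s IH] l /=; last by move=> [? ? ?] ?; split => //; exact: IH.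
case: s' => [|[x y] s'] lm /=; first exact: le_trans.
by move=> [mx xy ?]; split => //; exact: le_trans mx.
Qed.

Lemma chain_nth l s r i : chain l s r -> (i < size s)%N ->
  [/\ l <= (nth (0, 0) s i).1, (nth (0, 0) s i).1 <= (nth (0, 0) s i).2 &
      (nth (0, 0) s i).2 <= r].
Proof.
elim: s l i => [//|[x y] s IH] l [|i] [/= lx xy yr] si.
  by split => //; exact: chain_le yr.
have [h1 h2 h3] := IH _ _ yr si; split => //.
exact: le_trans lx (le_trans xy h1).
Qed.

Lemma chain_nth_lt l s r i j : chain l s r -> (i < j)%N -> (j < size s)%N ->
  (nth (0, 0) s i).2 <= (nth (0, 0) s j).1.
Proof.
elim: s l i j => [//|[x y] s IH] l i [|j] [/= lx xy yr] //.
case: i => [|i] ij js; first by have [] := chain_nth yr js.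
by move: ij js; rewrite !ltnS => ij js; apply: (IH y i j).
Qed.

Lemma abs_continuous_chain (V : normedModType R) (a b : R) (g : R -> V) :
  abs_continuous a b g -> forall e, 0 < e -> exists2 d, 0 < d &
    forall s, chain a s b -> \sum_(i <- s) (i.2 - i.1) < d ->
      \sum_(i <- s) `|g i.2 - g i.1| < e.
Proof.
move=> ac e e0; have [d d0 gd] := ac e e0; exists d => // s cs.
rewrite !(big_nth (0, 0)) !big_mkord => sd.
apply: (gd (size s) (fun i => (nth (0, 0) s i).1) (fun i => (nth (0, 0) s i).2)) => //.
  by move=> i; exact: chain_nth.
apply/trivIsetP => i j _ _ ij.
wlog lij : i j ij / (i < j)%N.
  move=> wl; have : (i : nat) != j by [].
  rewrite neq_ltn => /orP[|ji]; first exact: wl.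
  by rewrite setIC; apply: wl => //; rewrite eq_sym.
have le_ij := chain_nth_lt cs lij (ltn_ord j).
apply/seteqP; split => // x [] /=; rewrite !in_itv/= => /andP[_ h1] /andP[h2 _].
by have := lt_trans (lt_le_trans h1 le_ij) h2; rewrite ltxx.
Qed.

End Chain.

Lemma is_derive_gauge (R : realType) (V : normedModType R) (g : R -> V) (s : R) (v : V)
  (e : R) : 0 < e -> is_derive s 1 g v ->
  \forall d \near 0^'+, forall l r, l <= s -> s <= r -> s - d < l -> r < s + d ->
    `|g r - g l - (r - l) *: v| <= e * (r - l).
Proof.
move=> e0 [dg gv].
have gcvg : (fun h => h^-1 *: (g (h *: 1 + s) - g s)) @ 0^' --> v.
  by rewrite -gv; exact: dg.
have /cvgrPdist_le /(_ _ e0) := gcvg.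
rewrite /dnbhs /within/= => /nbhs_ballP[d /= d0 dP].
have side x : `|x - s| < d -> `|g x - g s - (x - s) *: v| <= e * `|x - s|.
  move=> xsd; have [->|xs] := eqVneq x s; first by rewrite !subrr scale0r subr0 !normr0 mulr0.
  have xs0 : x - s != 0 by rewrite subr_eq0.
  have := dP (x - s); rewrite /ball/= sub0r normrN => /(_ xsd xs0).
  rewrite scaler1 subrK => h.
  have -> : g x - g s - (x - s) *: v = - ((x - s) *: (v - (x - s)^-1 *: (g x - g s))).
    by rewrite scalerBr scalerA mulfV// scale1r opprB.
  by rewrite normrN normrZ mulrC ler_wpM2r.
near=> dl => l r ls sr sl rs.
have dld : dl <= d by near: dl; exact: nbhs_right_le.
have -> : g r - g l - (r - l) *: v =
    (g r - g s - (r - s) *: v) - (g l - g s - (l - s) *: v).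
  have -> : (r - l) *: v = (r - s) *: v - (l - s) *: v by rewrite -scalerBl; congr (_ *: _); ring.
  by rewrite [RHS]subrACA; congr (_ - _); rewrite opprB addrA subrK.
have -> : e * (r - l) = e * `|r - s| + e * `|l - s|.
  by rewrite (ger0_norm (_ : 0 <= r - s)) ?subr_ge0// ler0_norm ?subr_le0//; ring.
apply: le_trans (ler_normB _ _) _; apply: lerD; apply: side.
  by rewrite ger0_norm ?subr_ge0//; lra.
by rewrite ler0_norm ?subr_le0//; lra.
Unshelve. all: by end_near. Qed.

(** Convexity in plain scalars, without the type of scalars between 0 and 1. *)
Definition convex_closed {R : realType} {V : lmodType R} (C : set V) :=
  forall (k : R) v w, 0 <= k -> k <= 1 -> C v -> C w -> C (k *: v + (1 - k) *: w).

(** Weighted sums of elements of C are multiples of elements of C; the case of total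
weight 0 is included so that degenerate intervals need no separate treatment. *)
Lemma convex_closed_cat (R : realType) (V : lmodType R) (C : set V) (x y : R) v w :
  convex_closed C -> 0 <= x -> 0 <= y -> C v -> C w ->
  exists2 z, C z & (x + y) *: z = x *: v + y *: w.
Proof.
move=> cC x0 y0 Cv Cw; have [xy|xy] := eqVneq (x + y) 0.
  have [-> ->] : x = 0 /\ y = 0 by split; lra.
  by exists v; rewrite // add0r !scale0r addr0.
have xy0 : 0 < x + y by rewrite lt_def xy addr_ge0.
exists ((x / (x + y)) *: v + (1 - x / (x + y)) *: w).
  by apply: cC => //; rewrite ?divr_ge0 ?addr_ge0// ler_pdivrMr// mul1r lerDl.
by rewrite scalerDr !scalerA; congr (_ *: _ + _ *: _); field.
Qed.

Section MeanValue.
Context {R : realType} {n p : nat}.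
Variables (a b M : R) (xi F : R -> 'rV[R]_n) (G : R -> 'rV[R]_p).
Variable (C : set ('rV[R]_n * 'rV[R]_p)).
Hypotheses (ab : a <= b) (ac_xi : abs_continuous a b xi)
  (d_xi : \forall s \ae (@lebesgue_measure R), `[a, b]%classic s ->
            is_derive s (1 : R) xi (F s))
  (mG : forall j, @measurable_fun _ _ (@lebesgueType R) _ `[a, b] (fun s => G s ord0 j))
  (FM : forall s, a <= s <= b -> `|F s| <= M)
  (GM : forall s, a <= s <= b -> `|G s| <= M)
  (cC : convex_closed C)
  (FGC : forall s, a <= s <= b -> C (F s, G s)).

Let major j (sg : bool) (e : R) : 0 < e -> exists2 phi : R -> R,
    phi b - phi a <= (-1) ^+ sg *
      \int[@completed_lebesgue_measure R]_(s in `[a, b]) G s ord0 j + e &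
    forall s, a <= s <= b -> \forall d \near 0^'+,
      forall l r, a <= l -> l <= s -> s <= r -> r <= b -> s - d < l -> r < s + d ->
        (-1) ^+ sg * G s ord0 j * (r - l) <= phi r - phi l.
Proof.
move=> e0.
have mD : @measurable _ (@lebesgueType R) `[a, b] by exact: completed_measurable_itv.
have GjM s : a <= s <= b -> `|G s ord0 j| <= M.
  by move=> sab; apply: le_trans (GM sab); exact: row_norm_coord.
have [||phi h1 h2] := @major_function R (fun s => (-1) ^+ sg * G s ord0 j) a b M e ab e0.
- by apply: measurable_funM => //; exact: measurable_cst.
- by move=> s sab; rewrite normrM normr_sign mul1r; exact: GjM.
exists phi => //; rewrite -RintegralZl//.
apply: (@bounded_integrable _ _ _ _ _ _ M) => //.
change (completed_lebesgue_measure `[a, b]%classic < +oo)%E.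
by rewrite completed_measure_itv// ltry.
Qed.

(** The increment of xi and the integral of G are, up to e, the same convex combination
of the values (F s, G s).  Both are compared with one Riemann sum over a partition
given by Cousin's lemma.  At points where xi has derivative F, increments of xi are close to
F s times the length.  The other points form a null set inside an open set O of small
measure: the intervals chosen around them have small total length, hence xi varies little
on them by absolute continuity.  For G the major functions of all coordinates of G
and -G are used. *)
Lemma mean_value (e : R) : 0 < e -> exists w, [/\ C w,
  `|xi b - xi a - (b - a) *: w.1| <= e &
  `|\row_j \int[@completed_lebesgue_measure R]_(s in `[a, b]) (G s ord0 j)
     - (b - a) *: w.2| <= e].
Proof.
move=> e0.
have M0 : 0 <= M by rewrite (le_trans _ (FM (s := a) _))// lexx.
have e3 : 0 < e / 3 by rewrite divr_gt0.
have ba0 : 0 <= b - a by rewrite subr_ge0.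
pose eta := e / 3 / (b - a + 1).
have eta0 : 0 < eta by rewrite divr_gt0//; lra.
have etab : eta * (b - a) <= e / 3.
  rewrite /eta mulrAC ler_pdivrMr; last lra.
  by rewrite [leRHS]mulrDr mulr1 lerDl ltW.
have /choice [phi phiP] : forall js : 'I_p * bool, exists phi : R -> R,
    phi b - phi a <= (-1) ^+ js.2 *
      \int[@completed_lebesgue_measure R]_(s in `[a, b]) G s ord0 js.1 + e /\
    forall s, a <= s <= b -> \forall d \near 0^'+,
      forall l r, a <= l -> l <= s -> s <= r -> r <= b -> s - d < l -> r < s + d ->
        (-1) ^+ js.2 * G s ord0 js.1 * (r - l) <= phi r - phi l.
  by move=> [j sg]; have [phi h1 h2] := major j sg e0; exists phi.
have [d d0 acd] := abs_continuous_chain ac_xi e3.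
pose Bad := ~` [set s | `[a, b]%classic s -> is_derive s (1 : R) xi (F s)].
have Bad0 : ((@wlength R idfun)^* Bad)%mu = 0%E.
  by apply/negligible_outer_measure; exact: d_xi.
pose d1 := Num.min (d / 2) (e / 3 / (M + 1)).
have d10 : 0 < d1.
  by rewrite /d1 lt_min divr_gt0//= divr_gt0//; lra.
have d1d : d1 < d.
  by apply: (@le_lt_trans _ _ (d / 2)); rewrite ?ge_min ?lexx//; lra.
have Md1 : M * d1 <= e / 3.
  have : d1 <= e / 3 / (M + 1) by rewrite ge_min lexx orbT.
  rewrite ler_pdivlMr; last lra.
  by move: (ltW d10); lra.
have [ O [oO BO Od]] := outer_measure_open_le Bad d10.
rewrite Bad0 add0e in Od.
pose lenS (s : seq (R * R)) := \sum_(i <- s) (i.2 - i.1).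
pose varS (s : seq (R * R)) := \sum_(i <- s) `|xi i.2 - xi i.1|.
(* w is the convex combination collected so far, s the list of the intervals whose
   tags are exceptional. *)
pose Q l r := exists w, C w /\ exists s, [/\ chain l s r,
  lenS s <= open_length O l r,
  `|xi r - xi l - (r - l) *: w.1| <= eta * (r - l) + varS s + M * lenS s &
  forall js : 'I_p * bool, (-1) ^+ js.2 * w.2 ord0 js.1 * (r - l) <= phi js r - phi js l].
have : Q a b.
  apply: cousin ab _ _.
    move=> l m r al lm mr rb [w [Cw [s [cs sO sxi sphi]]]] [w' [Cw' [s' [cs' sO' sxi' sphi']]]].
    have ml0 : 0 <= m - l by rewrite subr_ge0.
    have rm0 : 0 <= r - m by rewrite subr_ge0.
    have [z Cz zE] := convex_closed_cat cC ml0 rm0 Cw Cw'.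
    have rlE : m - l + (r - m) = r - l by ring.
    rewrite rlE in zE.
    exists z; split => //; exists (s ++ s'); split.
    - exact: chain_cat cs cs'.
    - by rewrite /lenS big_cat/= (open_length_cat oO lm mr) lerD.
    - have -> : xi r - xi l - (r - l) *: z.1 =
        (xi m - xi l - (m - l) *: w.1) + (xi r - xi m - (r - m) *: w'.1).
        have -> : (r - l) *: z.1 = (m - l) *: w.1 + (r - m) *: w'.1.
          by have /(congr1 fst) := zE.
        by apply/rowP => i; rewrite !mxE; ring.
      apply: le_trans (ler_normD _ _) _; apply: le_trans (lerD sxi sxi') _.
      by rewrite /varS /lenS !big_cat/= -rlE; lra.
    - move=> [j sg] /=; have := sphi (j, sg); have := sphi' (j, sg) => /=.
      have : (r - l) * z.2 ord0 j = (m - l) * w.2 ord0 j + (r - m) * w'.2 ord0 j.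
        by have /(congr1 (fun v : 'rV[R]_n * 'rV[R]_p => v.2 ord0 j)) := zE; rewrite /= !mxE.
      move=> zj h' h; rewrite -mulrA (mulrC (z.2 _ _)) zj; lra.
  move=> s as_ sb; have sab : a <= s <= b by rewrite as_.
  have near_phi : \forall d \near 0^'+, forall js : 'I_p * bool,
      forall l r, a <= l -> l <= s -> s <= r -> r <= b -> s - d < l -> r < s + d ->
        (-1) ^+ js.2 * G s ord0 js.1 * (r - l) <= phi js r - phi js l.
    by apply: filter_forall => js; have [_] := phiP js; exact.
  have [der|nder] := pselect (is_derive s 1 xi (F s)).
    have near_xi := is_derive_gauge eta0 der.
    have [dl [dl0 dl1 dl2]] : exists dl : R, [/\ 0 < dl,
       forall l r, l <= s -> s <= r -> s - dl < l -> r < s + dl ->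
         `|xi r - xi l - (r - l) *: F s| <= eta * (r - l) &
       forall js : 'I_p * bool,
      forall l r, a <= l -> l <= s -> s <= r -> r <= b -> s - dl < l -> r < s + dl ->
        (-1) ^+ js.2 * G s ord0 js.1 * (r - l) <= phi js r - phi js l].
      apply: (@filter_ex _ (0^'+ : set_system R)); near=> dl; split.
      - by near: dl; exact: nbhs_right_gt.
      - by near: dl.
      - by near: dl.
    exists dl => // l r al ls sr rb sl rs.
    exists (F s, G s); split; first exact: FGC.
    have lr := le_trans ls sr.
    exists [::]; split => //=.
    - by rewrite /lenS big_nil open_length_ge0.
    - by rewrite /varS /lenS !big_nil mulr0 !addr0; exact: dl1.
    - by move=> js; exact: dl2.
  have Os : O s by apply: BO => /= der; apply: nder; apply: der; rewrite /= ?in_itv.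
  have [dl [dl0 dl1 dl2]] : exists dl : R, [/\ 0 < dl,
     forall l r, s - dl < l -> r < s + dl -> `]l, r] `<=` O &
     forall js : 'I_p * bool,
      forall l r, a <= l -> l <= s -> s <= r -> r <= b -> s - dl < l -> r < s + dl ->
        (-1) ^+ js.2 * G s ord0 js.1 * (r - l) <= phi js r - phi js l].
    have near_O := open_itv_nbhs oO Os.
    apply: (@filter_ex _ (0^'+ : set_system R)); near=> dl; split.
    - by near: dl; exact: nbhs_right_gt.
    - by near: dl.
    - by near: dl.
  exists dl => // l r al ls sr rb sl rs.
  exists (F s, G s); split; first exact: FGC.
  have lr := le_trans ls sr.
  have rl0 : 0 <= r - l by rewrite subr_ge0.
  exists [:: (l, r)]; split => //=.
  - by rewrite /lenS big_seq1 open_length_full//; exact: dl1.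
  - rewrite /varS /lenS !big_seq1/=.
    apply: le_trans (ler_normB _ _) _.
    have : `|(r - l) *: F s| <= M * (r - l).
      by rewrite normrZ ger0_norm// mulrC ler_wpM2r// FM.
    have : 0 <= eta * (r - l) by rewrite mulr_ge0// ltW.
    lra.
  - by move=> js; exact: dl2.
move=> [w [Cw [s [cs sO sxi sphi]]]]; exists w; split => //.
  have sd1 : lenS s <= d1.
    by apply: le_trans sO _; exact: open_length_le.
  have := acd s cs (le_lt_trans sd1 d1d); rewrite -/(varS s) => sv.
  have : M * lenS s <= M * d1 by exact: ler_wpM2l.
  lra.
apply: row_norm_le => [|j]; first exact: ltW.
have := sphi (j, true); have := sphi (j, false) => /=.
have [+ _] := phiP (j, true); have [+ _] := phiP (j, false); rewrite /= !mxE.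
rewrite expr0 expr1 !mul1r !mulN1r ler_norml => h1 h2 h3 h4.
by apply/andP; split; lra.
Unshelve. all: by end_near. Qed.

End MeanValue.

(** * Integrals of bounded measurable vector functions *)

Section VectorIntegral.
Context {R : realType} {d : nat}.
Implicit Types (q : R -> 'rV[R]_d) (a b c l r M : R).

Definition vint l r q : 'rV[R]_d :=
  \row_j \int[@completed_lebesgue_measure R]_(s in `[l, r]) (q s ord0 j).

Definition bounded_measurable l r M q :=
  (forall j, @measurable_fun _ _ (@lebesgueType R) _ `[l, r] (fun s => q s ord0 j)) /\
  (forall s, l <= s <= r -> `|q s| <= M).

Lemma bounded_measurableS l r M q l' r' : l <= l' -> r' <= r ->
  bounded_measurable l r M q -> bounded_measurable l' r' M q.
Proof.
move=> ll rr [mq bq]; split => [j|s /andP[h1 h2]]; last first.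
  by apply: bq; rewrite (le_trans ll h1) (le_trans h2 rr).
apply: measurable_funS (mq j); first exact: completed_measurable_itv.
move=> s /=; rewrite !in_itv/= => /andP[h1 h2].
by rewrite (le_trans ll h1) (le_trans h2 rr).
Qed.

Lemma bounded_measurable_integrable l r M q j : l <= r -> bounded_measurable l r M q ->
  (@completed_lebesgue_measure R).-integrable `[l, r] (EFin \o (fun s => q s ord0 j)).
Proof.
move=> lr [mq bq]; apply: (@bounded_integrable _ _ _ _ _ _ M).
- exact: completed_measurable_itv.
- change (completed_lebesgue_measure `[l, r]%classic < +oo)%E.
  by rewrite completed_measure_itv// ltry.
- exact: mq.
- move=> s /=; rewrite in_itv/= => slr; apply: le_trans (bq s slr).
  exact: row_norm_coord.
Qed.

Lemma completed_Rintegral_cst l r (k : R) : l <= r ->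
  \int[@completed_lebesgue_measure R]_(s in `[l, r]) k = k * (r - l).
Proof.
move=> lr; transitivity (k * fine (@completed_lebesgue_measure R `[l, r]%classic)).
  by apply: Rintegral_cst; exact: completed_measurable_itv.
by rewrite completed_measure_itv.
Qed.

Lemma vint_bound l r M q (v : 'rV[R]_d) rho : l <= r -> 0 <= rho ->
  bounded_measurable l r M q ->
  (forall s, l <= s <= r -> `|q s - v| <= rho) ->
  `|vint l r q - (r - l) *: v| <= (r - l) * rho.
Proof.
move=> lr rho0 mq qv; have rl0 : 0 <= r - l by rewrite subr_ge0.
apply: row_norm_le => [|j]; first exact: mulr_ge0.
rewrite !mxE; have iq := bounded_measurable_integrable j lr mq.
have mD : @measurable _ (@lebesgueType R) `[l, r] by exact: completed_measurable_itv.
have icst (k : R) : (@completed_lebesgue_measure R).-integrable `[l, r] (EFin \o cst k).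
  apply: (@bounded_integrable _ _ _ _ _ _ `|k|) => //.
  change (completed_lebesgue_measure `[l, r]%classic < +oo)%E.
  by rewrite completed_measure_itv// ltry.
have qvj s : s \in `[l, r]%classic -> v ord0 j - rho <= q s ord0 j <= v ord0 j + rho.
  rewrite inE/= in_itv/= => slr; have := le_trans (row_norm_coord _ j) (qv s slr).
  by rewrite !mxE ler_norml => /andP[h1 h2]; apply/andP; split; lra.
have lo : \int[@completed_lebesgue_measure R]_(s in `[l, r]) (v ord0 j - rho) <=
    \int[@completed_lebesgue_measure R]_(s in `[l, r]) (q s ord0 j).
  apply: le_Rintegral mD _ _ _ => [| |s slr]; [exact: icst|exact: iq|].
  by have /andP[] := qvj s (mem_set slr).
have hi : \int[@completed_lebesgue_measure R]_(s in `[l, r]) (q s ord0 j) <=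
    \int[@completed_lebesgue_measure R]_(s in `[l, r]) (v ord0 j + rho).
  apply: le_Rintegral mD _ _ _ => [| |s slr]; [exact: iq|exact: icst|].
  by have /andP[] := qvj s (mem_set slr).
rewrite !completed_Rintegral_cst// in lo hi.
by rewrite ler_norml; apply/andP; split; lra.
Qed.

Lemma vintB l r M M' q q' : l <= r ->
  bounded_measurable l r M q -> bounded_measurable l r M' q' ->
  vint l r (fun s => q s - q' s) = vint l r q - vint l r q'.
Proof.
move=> lr mq mq'; apply/rowP => j; rewrite !mxE.
under eq_Rintegral do rewrite !mxE.
apply: RintegralB; first exact: completed_measurable_itv.
- exact: bounded_measurable_integrable mq.
- exact: bounded_measurable_integrable mq'.
Qed.

Lemma bounded_measurableB l r M M' q q' :
  bounded_measurable l r M q -> bounded_measurable l r M' q' ->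
  bounded_measurable l r (M + M') (fun s => q s - q' s).
Proof.
move=> [mq bq] [mq' bq']; split => [j|s slr].
  rewrite (_ : (fun s => _) = (fun s => q s ord0 j - q' s ord0 j)).
    exact: measurable_funB.
  by apply/funext => s; rewrite !mxE.
by apply: le_trans (ler_normB _ _) _; apply: lerD; [exact: bq|exact: bq'].
Qed.

Lemma completed_Rintegral_oc (g : R -> R) b c : b <= c ->
  (@completed_lebesgue_measure R).-integrable `[b, c] (EFin \o g) ->
  \int[@completed_lebesgue_measure R]_(s in `[b, c]) g s =
  \int[@completed_lebesgue_measure R]_(s in `]b, c]) g s.
Proof.
move=> bc ig; rewrite /Rintegral; congr fine.
have E : (`[b, c] `\` `[b, b] = `]b, c])%classic.
  apply/seteqP; split => s /=; rewrite !in_itv/=.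
    move=> [/andP[bs ->] sb]; rewrite andbT lt_neqAle bs andbT.
    by apply/eqP => sb'; apply: sb; rewrite -sb' lexx.
  move=> /andP[bs ->]; rewrite (ltW bs); split => // /andP[_].
  by rewrite leNgt bs.
rewrite -E; apply: negligible_integral => //; try exact: completed_measurable_itv.
change (completed_lebesgue_measure `[b, b]%classic = 0)%E.
by rewrite completed_measure_itv// subrr.
Qed.

Lemma vint_cat M q a b c : a <= b -> b <= c -> bounded_measurable a c M q ->
  vint a c q = vint a b q + vint b c q.
Proof.
move=> ab bc mq; apply/rowP => j; rewrite !mxE.
rewrite (completed_Rintegral_oc bc); last first.
  by apply: bounded_measurable_integrable bc (bounded_measurableS ab _ mq).
have E : (`[a, c] = `[a, b] `|` `]b, c])%classic.
  apply/seteqP; split => s /=; rewrite !in_itv/=.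
    by move=> /andP[as_ sc]; have [sb|bs] := leP s b; [left|right]; apply/andP.
  case=> /andP[h1 h2]; apply/andP; split => //; first exact: le_trans bc.
  exact: le_trans ab (ltW h1).
rewrite E; apply: Rintegral_setU.
- exact: completed_measurable_itv.
- exact: completed_measurable_itv.
- by rewrite -E; apply: bounded_measurable_integrable (le_trans ab bc) mq.
- apply/disj_setPS => s [] /=; rewrite !in_itv/= => /andP[_ sb] /andP[].
  by rewrite ltNge sb.
Qed.

(** The left end point does not matter; this is where a control switches. *)
Lemma vint_oc_eq M M' q q' b c : b <= c ->
  bounded_measurable b c M q -> bounded_measurable b c M' q' ->
  (forall s, b < s <= c -> q s = q' s) -> vint b c q = vint b c q'.
Proof.
move=> bc mq mq' qq; apply/rowP => j; rewrite !mxE.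
rewrite !(completed_Rintegral_oc bc); last 2 first.
- exact: bounded_measurable_integrable bc mq'.
- exact: bounded_measurable_integrable bc mq.
by apply: eq_Rintegral => s; rewrite inE/= in_itv/= => sbc; rewrite qq.
Qed.

Lemma vint_eq q q' b c :
  (forall s, b <= s <= c -> q s = q' s) -> vint b c q = vint b c q'.
Proof.
move=> qq; apply/rowP => j; rewrite !mxE.
by apply: eq_Rintegral => s; rewrite inE/= in_itv/= => sbc; rewrite qq.
Qed.

Lemma vintxx q a M : bounded_measurable a a M q -> vint a a q = 0.
Proof.
move=> mq; have := @vint_bound a a M q 0 `|M| (lexx a) (normr_ge0 M) mq.
rewrite subrr scale0r subr0 mul0r => h; apply/eqP; rewrite -normr_le0; apply: h.
by move=> s sa; rewrite subr0; apply: le_trans (ler_norm _); case: mq => _; apply.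
Qed.

End VectorIntegral.

Lemma lipschitz_bounded_measurable (R : realType) (d : nat) (q : R -> 'rV[R]_d) (l r M c : R) :
  (forall s s', `|q s - q s'| <= c * `|s - s'|) -> (forall s, `|q s| <= M) ->
  bounded_measurable l r M q.
Proof.
move=> qc qM; split; last by move=> s _; exact: qM.
move=> j mD B mB.
suff : measurable_fun (`[l, r]%classic : set (measurableTypeR R)) (fun s => q s ord0 j).
  by move=> /(_ (measurable_itv _) B mB) mq; apply: sub_caratheodory.
apply: measurable_funTS; apply: continuous_measurable_fun => s.
apply/cvgrPdist_le => e e0; near=> s'.
have -> : q s ord0 j - q s' ord0 j = (q s - q s') ord0 j by rewrite !mxE.
apply: le_trans (row_norm_coord _ _) _; apply: le_trans (qc _ _) _.
have c1 : 0 < `|c| + 1 by rewrite ltr_wpDl.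
apply: (@le_trans _ _ ((`|c| + 1) * `|s - s'|)).
  by rewrite ler_wpM2r// (le_trans (ler_norm c))// lerDl.
rewrite -ler_pdivlMl//; near: s'.
have e'0 : 0 < (`|c| + 1)^-1 * e by rewrite mulr_gt0// invr_gt0.
by apply/nbhs_ballP; exists ((`|c| + 1)^-1 * e) => //= z /ltW.
Unshelve. all: by end_near. Qed.

(** Joint continuity of L together with measurability of the control does not give
measurability of the running cost by composition alone, because the state moves as well.  For a
fixed state it does; a moving state is replaced by its samples at the times of
a finer and finer grid, which converge because L is Lipschitz in the state. *)
Section Composite.
Context {R : realType} {n m p : nat}.
Variables (T : R) (U : set 'rV[R]_m) (L : 'rV[R]_n -> 'rV[R]_m -> 'rV[R]_p) (KL : R).
Hypotheses (L_continuous : {within [set: 'rV[R]_n] `*` U,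
     continuous (fun q : 'rV[R]_n * 'rV[R]_m => L q.1 q.2)})
  (KL_ge0 : 0 <= KL)
  (L_lipschitz : forall x y u, U u -> `|L x u - L y u| <= KL * `|x - y|).

Lemma measurable_fixed_state (x : 'rV[R]_n) (u : R -> 'rV[R]_m) j : controls T U u ->
  @measurable_fun _ _ (@lebesgueType R) _ `[0, T] (fun s => L x (u s) ord0 j).
Proof.
move=> [uU _ mu] mD; apply: (measurability _ (RGenOpens.measurableE R)) => //.
move=> _ [_ [a [b ->] <-]].
pose W : set 'rV[R]_m := interior [set v | U v -> `]a, b[%classic (L x v ord0 j)].
have oW : open W by exact: open_interior.
have mW : @measurable _ (g_sigma_algebraType (@open 'rV[R]_m)) W by exact: sub_sigma_algebra.
have := mu mD W mW.
congr measurable; apply/seteqP; split => s [sT].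
  by move=> Ws; split => //; apply: (@interior_subset _ _ _ Ws); exact: uU.
move=> /= Ls; split => //.
have /subspace_continuousP Lc := L_continuous.
have Lxus : ([set: 'rV[R]_n] `*` U) (x, u s) by split => //; exact: uU.
have near_ab : nbhs (L x (u s)) [set y | `]a, b[%classic (y ord0 j)].
  have : `]a, b[%classic ((fun y : 'rV[R]_p => y ord0 j) (L x (u s))) by [].
  move=> h; apply: (@coord_continuous _ _ _ ord0 j (L x (u s)) `]a, b[%classic).
  by apply: open_nbhs_nbhs; split => //; exact: interval_open.
have := Lc (x, u s) Lxus _ near_ab; rewrite /= /within/= => near_q.
case: near_q => -[/= A B] [/= nA nB] AB; apply: filterS nB => v Bv Uv.
by apply: (AB (x, v)); split => //=; exact: nbhs_singleton.
Qed.

Lemma measurable_running_cost (u : R -> 'rV[R]_m) (xi : R -> 'rV[R]_n) (a b c : R) j :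
  controls T U u -> 0 <= a -> b <= T -> 0 <= c ->
  (forall s s', a <= s <= b -> a <= s' <= b -> `|xi s - xi s'| <= c * `|s - s'|) ->
  @measurable_fun _ _ (@lebesgueType R) _ `[a, b] (fun s => L (xi s) (u s) ord0 j).
Proof.
move=> cu a0 bT c0 xic.
have uU : forall s, a <= s <= b -> U (u s).
  move=> s /andP[as_ sb]; have [+ _ _] := cu; apply; rewrite /= in_itv/=.
  by rewrite (le_trans a0 as_) (le_trans sb bT).
(* rho k s is the last multiple of 1 / (k + 1) after a that does not exceed s. *)
pose K (k : nat) : R := k.+1%:R.
have K0 k : 0 < K k by rewrite ltr0n.
pose tr k s := Num.truncn ((s - a) * K k).
pose rho k s := a + (tr k s)%:R / K k.
have rhoP k s : a <= s -> a <= rho k s <= s /\ s - rho k s <= (K k)^-1.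
  move=> as_; have sa0 : 0 <= (s - a) * K k by rewrite mulr_ge0 ?subr_ge0// ltW.
  have /andP[h1 h2] := truncn_itv sa0.
  rewrite -ler_pdivrMr// in h1; rewrite -ltr_pdivlMr// -natr1 mulrDl mul1r in h2.
  have h0 : 0 <= (tr k s)%:R / K k by rewrite divr_ge0// ltW.
  rewrite /rho -/(tr k s) in h1 h2 *.
  move: h0 h1 h2; set X := _ / K k; set Y := (K k)^-1 => h0 h1 h2.
  by split; [apply/andP; split|]; lra.
refine (measurable_fun_cvg (T := @lebesgueType R)
  (h := fun k s => L (xi (rho k s)) (u s) ord0 j) _ _); last first.
  move=> s; rewrite /= in_itv/= => sab; have /andP[as_ sb] := sab.
  apply/cvgrPdist_le => e e0.
  have d0 : 0 < e / (KL * c + 1) by rewrite divr_gt0// ltr_wpDl// mulr_ge0.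
  have : \forall k \near \oo, (K k)^-1 < e / (KL * c + 1).
    exact: near_infty_natSinv_lt (PosNum d0).
  apply: filterS => k kd.
  have [/andP[h1 h2] h3] := rhoP k s as_.
  have -> : L (xi s) (u s) ord0 j - L (xi (rho k s)) (u s) ord0 j =
    (L (xi s) (u s) - L (xi (rho k s)) (u s)) ord0 j by rewrite !mxE.
  apply: le_trans (row_norm_coord _ _) _.
  apply: le_trans (L_lipschitz _ _ (uU s sab)) _.
  have : `|xi s - xi (rho k s)| <= c * `|s - rho k s|.
    by apply: xic => //; rewrite h1 (le_trans h2 sb).
  rewrite ger0_norm ?subr_ge0// => /(ler_wpM2l KL_ge0) h; apply: le_trans h _.
  rewrite mulrA; have KLc : 0 <= KL * c by exact: mulr_ge0.
  have h4 := le_lt_trans h3 kd.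
  rewrite ltr_pdivlMr in h4; last by rewrite ltr_wpDl.
  by rewrite mulrC; have : 0 <= s - rho k s by [rewrite subr_ge0]; lra.
move=> k.
pose E (i : nat) : set R := `[a, b]%classic `&` `[a + i%:R / K k, a + i.+1%:R / K k[%classic.
have mE i : @measurable _ (@lebesgueType R) (E i).
  by apply: measurableI; exact: completed_measurable_itv.
have EU : `[a, b]%classic = \bigcup_i E i.
  apply/seteqP; split => [s sab|s [i _ []//]].
  have /andP[as_ sb] : a <= s <= b by move: sab; rewrite /= in_itv.
  have sa0 : 0 <= (s - a) * K k by rewrite mulr_ge0 ?subr_ge0// ltW.
  exists (tr k s) => //; split => //; rewrite /= in_itv/=.
  have /andP[h1 h2] := truncn_itv sa0.
  rewrite -ler_pdivrMr// in h1; rewrite -ltr_pdivlMr// in h2.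
  by rewrite -lerBrDl -ltrBlDl h1 h2.
rewrite EU; apply/(measurable_fun_bigcup _ mE) => i.
apply: (eq_measurable_fun (T1 := @lebesgueType R) (fun s => L (xi (a + i%:R / K k)) (u s) ord0 j)).
  move=> s; rewrite inE => -[]; rewrite /= !in_itv/= => /andP[as_ _].
  rewrite -lerBrDl -ltrBlDl ler_pdivrMr// ltr_pdivlMr// => h.
  by rewrite /rho /tr (truncn_def h).
apply: measurable_funS (measurable_fixed_state (xi (a + i%:R / K k)) j cu).
  exact: completed_measurable_itv.
move=> s [+ _]; rewrite /= !in_itv/= => /andP[as_ sb].
by rewrite (le_trans a0 as_) (le_trans sb bT).
Qed.

End Composite.

(** * Solutions for a constant control *)

Lemma addrKl (V : zmodType) (x a b : V) : (x + a) - (x + b) = a - b.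
Proof. by rewrite opprD addrACA subrr add0r. Qed.

Lemma le0_of_geometric (R : realType) (y c : R) :
  (forall k : nat, y <= c / 2 ^+ k) -> y <= 0.
Proof.
move=> yc; rewrite leNgt; apply/negP => y0.
pose k := (Num.truncn (c / y)).+1.
have : c / y < k%:R by exact: truncnS_gt.
rewrite ltr_pdivrMr// => h.
have := yc k; rewrite ler_pdivlMr ?exprn_gt0//.
have : k%:R <= 2 ^+ k :> R by rewrite -natrX ler_nat ltnW// ltn_expl.
rewrite -(ler_pM2l y0); lra.
Qed.

(** The intervals of radius 2 D / 2 ^ k around u k are nested; the limit is the supremum of
their left ends. *)
Lemma geometric_limit (R : realType) (u : nat -> R) (D : R) :
  (forall k, `|u k.+1 - u k| <= D / 2 ^+ k) ->
  exists l, forall k, `|u k - l| <= 2 * D / 2 ^+ k.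
Proof.
move=> uD; pose r k := 2 * D / 2 ^+ k.
have rS k : r k = D / 2 ^+ k + r k.+1.
  by rewrite /r exprS; field; rewrite expf_neq0.
have lo j k : u k - r k <= u (k + j)%N - r (k + j)%N.
  elim: j => [|j IH]; first by rewrite addn0.
  apply: le_trans IH _; rewrite addnS (rS (k + j)%N).
  have := uD (k + j)%N; rewrite ler_norml => /andP[h1 h2]; lra.
have hi j k : u (k + j)%N + r (k + j)%N <= u k + r k.
  elim: j => [|j IH]; first by rewrite addn0.
  apply: le_trans _ IH; rewrite addnS (rS (k + j)%N).
  have := uD (k + j)%N; rewrite ler_norml => /andP[h1 h2]; lra.
have r0 k : 0 <= r k.
  have D0 : 0 <= D by have := uD 0%N; rewrite expr0 divr1; apply: le_trans.
  by rewrite /r divr_ge0 ?exprn_ge0// mulr_ge0.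
have lohi j k : u j - r j <= u k + r k.
  have h1 := lo k j; have h2 := hi j k; rewrite addnC in h2.
  apply: le_trans h1 _; apply: le_trans h2; have := r0 (j + k)%N; lra.
pose S := range (fun k => u k - r k).
have S0 : S !=set0 by exists (u 0%N - r 0%N); exists 0%N.
exists (sup S) => k.
have h1 : u k - r k <= sup S.
  apply: ub_le_sup; last by exists k.
  by exists (u 0%N + r 0%N) => _ [j _ <-]; exact: lohi.
have h2 : sup S <= u k + r k by apply: ge_sup => // _ [j _ <-]; exact: lohi.
by rewrite -/(r k) ler_norml; apply/andP; split; lra.
Qed.

Lemma is_derive_of_quadratic (R : realType) (V : normedModType R) (g : R -> V) (s : R)
  (v : V) (d C : R) : 0 < d -> 0 <= C ->
  (forall s', `|s' - s| < d -> `|g s' - g s - (s' - s) *: v| <= C * `|s' - s| ^+ 2) ->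
  is_derive s 1 g v.
Proof.
move=> d0 C0 gC.
have gcvg : (fun h => h^-1 *: (g (h *: 1 + s) - g s)) @ 0^' --> v.
  apply/cvgrPdist_le => e e0.
  have e'0 : 0 < Num.min d (e / (C + 1)).
    by rewrite lt_min d0 divr_gt0// ltr_wpDl.
  rewrite /at_right /dnbhs /within/=; apply/nbhs_ballP.
  exists (Num.min d (e / (C + 1))) => //= h.
  rewrite /ball/= sub0r normrN lt_min => /andP[hd he] h0.
  have hsE : h *: 1 + s - s = h by rewrite addrK scaler1.
  have := gC (h *: 1 + s); rewrite hsE => /(_ hd) gh.
  have -> : v - h^-1 *: (g (h *: 1 + s) - g s) =
      - (h^-1 *: (g (h *: 1 + s) - g s - h *: v)).
    by rewrite [in RHS]scalerBr scalerA mulVf// scale1r opprB.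
  rewrite normrN normrZ normfV ler_pdivrMl ?normr_gt0//.
  apply: le_trans gh _; rewrite expr2 mulrCA ler_wpM2l//.
  rewrite ltr_pdivlMr ?ltr_wpDl// in he.
  have := normr_ge0 h; lra.
by split; [apply/cvg_ex; exists v|exact: cvg_lim].
Qed.

(** Picard iteration.  On an interval with K (b - a) at most 1 / 2 the integral operator
halves uniform distances, so the iterates converge geometrically.  Time is clamped to
[a, b] ([cl]) in order that all functions involved be Lipschitz on the whole
line; the short interval is enough because pieces can be glued. *)
Section Picard.
Context {R : realType} {n : nat}.
Variables (g : 'rV[R]_n -> 'rV[R]_n) (M K : R) (x : 'rV[R]_n) (a b : R).
Hypotheses (K0 : 0 <= K) (gK : forall y z, `|g y - g z| <= K * `|y - z|)
  (gM : forall y, `|g y| <= M) (ab : a <= b) (Kab : K * (b - a) <= 2^-1).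

Let M0 : 0 <= M. Proof. exact: le_trans (gM 0). Qed.

Let cl s := Num.max a (Num.min b s).

Let cl_a s : a <= cl s. Proof. by rewrite /cl le_max lexx. Qed.
Let cl_b s : cl s <= b. Proof. by rewrite /cl ge_max ab ge_min lexx. Qed.
Let cl_mono s s' : s <= s' -> cl s <= cl s' /\ cl s' - cl s <= s' - s.
Proof.
rewrite /cl /Num.max /Num.min => ss'.
by case: ifP; case: ifP; case: ifP; case: ifP; move=> *; split; lra.
Qed.
Let cl_id s : a <= s -> s <= b -> cl s = s.
Proof. by move=> as_ sb; rewrite /cl min_r// max_r. Qed.

Let lip h := forall s s' : R, `|h s - h s' : 'rV[R]_n| <= M * `|s - s'|.

Let mlip h l r : lip h -> bounded_measurable l r M (g \o h).
Proof.
move=> lh; apply: (@lipschitz_bounded_measurable _ _ _ _ _ _ (K * M)) => [s s'|s]; last exact: gM.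
by apply: le_trans (gK _ _) _; rewrite -mulrA ler_wpM2l.
Qed.

Let Phi (h : R -> 'rV[R]_n) s := x + vint a (cl s) (g \o h).

Let Phi_lip h : lip h -> lip (Phi h).
Proof.
move=> lh s s'; wlog ss' : s s' / s' <= s.
  move=> wl; have [|/ltW] := leP s' s; first exact: wl.
  by rewrite distrC (distrC s); exact: wl.
have [c1 c2] := cl_mono ss'.
rewrite /Phi addrKl (vint_cat (cl_a s') c1 (mlip _ _ lh)) addrAC subrr add0r.
have := @vint_bound _ _ _ _ _ _ 0 M c1 M0 (mlip (cl s') (cl s) lh).
rewrite scaler0 subr0 => h1; apply: le_trans (h1 _) _ => [r _|].
  by rewrite subr0; exact: gM.
by rewrite mulrC ler_wpM2l// ger0_norm// subr_ge0.
Qed.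

Let Phi_contr h h' d : lip h -> lip h' -> (forall s, `|h s - h' s| <= d) ->
  forall s, `|Phi h s - Phi h' s| <= d / 2.
Proof.
move=> lh lh' hd s; rewrite /Phi addrKl -(vintB (cl_a s) (mlip _ _ lh) (mlip _ _ lh')).
have d0 : 0 <= d by exact: le_trans (hd a).
have := @vint_bound _ _ _ _ _ _ 0 (K * d) (cl_a s) (mulr_ge0 K0 d0)
  (bounded_measurableB (mlip a (cl s) lh) (mlip a (cl s) lh')).
rewrite scaler0 subr0 => h1; apply: le_trans (h1 _) _ => [r _|].
  by rewrite subr0; apply: le_trans (gK _ _) _; exact: ler_wpM2l.
have -> : (cl s - a) * (K * d) = d * (K * (cl s - a)) by ring.
apply: ler_wpM2l => //; apply: le_trans Kab.
by apply: ler_wpM2l => //; rewrite lerD2r.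
Qed.

Let hs k := iter k Phi (cst x).

Let hs_lip k : lip (hs k).
Proof.
elim: k => [|k IH]; last exact: Phi_lip.
by move=> s s'; rewrite /= subrr normr0 mulr_ge0.
Qed.

Let hsD k s : `|hs k.+1 s - hs k s| <= M * (b - a) / 2 ^+ k.
Proof.
elim: k s => [|k IH] s.
  rewrite expr0 divr1 /= /Phi addrAC subrr add0r.
  have := @vint_bound _ _ _ _ _ _ 0 M (cl_a s) M0 (mlip a (cl s) (hs_lip 0)).
  rewrite scaler0 subr0 => h1; apply: le_trans (h1 _) _ => [r _|].
    by rewrite subr0; exact: gM.
  by rewrite mulrC ler_wpM2l// lerD2r.
rewrite exprS invfM mulrCA mulrC.
by apply: (Phi_contr (hs_lip k.+1) (hs_lip k)).
Qed.

Lemma picard : exists zeta : R -> 'rV[R]_n, [/\ zeta a = x,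
  forall s s', `|zeta s - zeta s'| <= M * `|s - s'|,
  forall s, a < s -> s < b -> is_derive s (1 : R) zeta (g (zeta s)) &
  zeta b - zeta a = vint a b (g \o zeta)].
Proof.
have /choice [z zP] : forall sj : R * 'I_n, exists l, forall k,
    `|hs k sj.1 ord0 sj.2 - l| <= 2 * (M * (b - a)) / 2 ^+ k.
  move=> [s j] /=; apply: geometric_limit => k; apply: le_trans (hsD k s).
  by apply: le_trans (row_norm_coord _ j); rewrite !mxE.
pose r k : R := 2 * (M * (b - a)) / 2 ^+ k.
have r0 k : 0 <= r k.
  by rewrite divr_ge0 ?exprn_ge0// !mulr_ge0// subr_ge0.
pose zeta s : 'rV[R]_n := \row_j z (s, j).
have zetaP k s : `|hs k s - zeta s| <= r k.
  by apply: row_norm_le => // j; rewrite !mxE; exact: (zP (s, j)).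
have zlip : lip zeta.
  move=> s s'; rewrite -subr_le0; apply: (@le0_of_geometric _ _ (4 * (M * (b - a)))) => k.
  have -> : zeta s - zeta s' = (hs k s - hs k s') - ((hs k s - zeta s) - (hs k s' - zeta s')).
    by rewrite [RHS]subrACA !subKr.
  have := ler_normB (hs k s - hs k s') ((hs k s - zeta s) - (hs k s' - zeta s')).
  have := ler_normB (hs k s - zeta s) (hs k s' - zeta s').
  have := zetaP k s; have := zetaP k s'; have := hs_lip k s s'.
  have -> : 4 * (M * (b - a)) / 2 ^+ k = 2 * r k by rewrite /r; ring.
  lra.
have zfix s : zeta s = Phi zeta s.
  apply/eqP; rewrite -subr_eq0 -normr_le0.
  apply: (@le0_of_geometric _ _ (4 * (M * (b - a)))) => k.
  have -> : zeta s - Phi zeta s = (hs k.+1 s - Phi zeta s) - (hs k.+1 s - zeta s).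
    by rewrite [RHS]addrC opprB subrKA.
  have := ler_normB (hs k.+1 s - Phi zeta s) (hs k.+1 s - zeta s).
  have := zetaP k.+1 s; have := Phi_contr (hs_lip k) zlip (zetaP k) s.
  have -> : r k.+1 = r k / 2 by rewrite /r exprS; field; rewrite expf_neq0.
  have -> : 4 * (M * (b - a)) / 2 ^+ k = 2 * r k by rewrite /r; ring.
  rewrite -/(hs k.+1); have := r0 k; lra.
have E l t : a <= l -> l <= t -> t <= b -> zeta t - zeta l = vint l t (g \o zeta).
  move=> al lt tb; rewrite zfix [zeta l]zfix /Phi addrKl !cl_id//; last 2 first.
  - exact: le_trans lt tb.
  - exact: le_trans al lt.
  by rewrite (vint_cat al lt (mlip a t zlip)) addrAC subrr add0r.
exists zeta; split => //; last exact: E.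
  rewrite zfix /Phi cl_id// (vintxx (mlip a a zlip)) addr0//.
move=> s as_ sb.
have d0 : 0 < Num.min (s - a) (b - s) by rewrite lt_min !subr_gt0 as_.
apply: (is_derive_of_quadratic d0 (mulr_ge0 K0 M0)) => s'.
rewrite lt_min !ltr_norml => /andP[/andP[h1 h2] /andP[h3 h4]].
have as' : a <= s' by lra.
have sb' : s' <= b by lra.
have B l t : l <= t -> l <= s <= t -> `|vint l t (g \o zeta) - (t - l) *: g (zeta s)| <=
    (t - l) * (K * (M * (t - l))).
  move=> lt /andP[ls st]; have tl0 : 0 <= t - l by rewrite subr_ge0.
  apply: (vint_bound lt _ (mlip l t zlip)) => [|q /andP[lq qt]].
    by rewrite !mulr_ge0.
  apply: le_trans (gK _ _) _; rewrite ler_wpM2l//; apply: le_trans (zlip _ _) _.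
  by rewrite ler_wpM2l// ler_norml; apply/andP; split; lra.
have [ss'|s's] := leP s s'.
  rewrite (E s s' (ltW as_) ss' sb'); apply: le_trans (B s s' ss' _) _.
    by rewrite lexx.
  by rewrite ger0_norm ?subr_ge0// expr2; lra.
have {}s's := ltW s's.
have -> : zeta s' - zeta s - (s' - s) *: g (zeta s) =
    - (zeta s - zeta s' - (s - s') *: g (zeta s)).
  by rewrite opprB opprB -(opprB s s') scaleNr opprK addrC.
rewrite normrN (E s' s as' s's (ltW sb)); apply: le_trans (B s' s s's _) _.
  by rewrite s's lexx.
by rewrite distrC ger0_norm ?subr_ge0// expr2; lra.
Qed.

End Picard.

(** * Trajectories and attainable costs *)

Lemma lipschitz_abs_continuous (R : realType) (V : normedModType R) (a b c : R) (g : R -> V) :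
  0 <= c ->
  (forall l r, a <= l -> l <= r -> r <= b -> `|g r - g l| <= c * (r - l)) ->
  abs_continuous a b g.
Proof.
move=> c0 gc e e0; have c1 : 0 < c + 1 by rewrite ltr_wpDl.
exists (e / (c + 1)); first exact: divr_gt0.
move=> N l r lr _; rewrite ltr_pdivlMr// => sd.
have : \sum_i `|g (r i) - g (l i)| <= \sum_i c * (r i - l i).
  by apply: ler_sum => i _; have [h1 h2 h3] := lr i; exact: gc.
have s0 : 0 <= \sum_i (r i - l i).
  by apply: sumr_ge0 => i _; have [_ h _] := lr i; rewrite subr_ge0.
rewrite -mulr_sumr; lra.
Qed.

Lemma abs_continuousS (R : realType) (V : normedModType R) (a b a' b' : R) (g : R -> V) :
  a <= a' -> b' <= b -> abs_continuous a b g -> abs_continuous a' b' g.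
Proof.
move=> aa bb ac e e0; have [d d0 gd] := ac e e0; exists d => // N l r lr.
apply: gd => i; have [h1 h2 h3] := lr i.
by split => //; [exact: le_trans h1|exact: le_trans bb].
Qed.

Section System.
Context {R : realType} {n m p : nat}.
Variables (T : R) (U : set 'rV[R]_m).
Hypothesis (U_nonempty : U !=set0).
Variables (f : 'rV[R]_n -> 'rV[R]_m -> 'rV[R]_n)
          (L : 'rV[R]_n -> 'rV[R]_m -> 'rV[R]_p).
Variables (Mf ML K : R).
Hypotheses (Mf_ge0 : 0 <= Mf) (ML_ge0 : 0 <= ML) (K_ge0 : 0 <= K)
  (L_continuous : {within [set: 'rV[R]_n] `*` U,
     continuous (fun q : 'rV[R]_n * 'rV[R]_m => L q.1 q.2)})
  (f_bounded : forall x u, U u -> `|f x u| <= Mf)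
  (L_bounded : forall x u, U u -> `|L x u| <= ML)
  (f_lipschitz : forall x y u, U u -> `|f x u - f y u| <= K * `|x - y|)
  (L_lipschitz : forall x y u, U u -> `|L x u - L y u| <= K * `|x - y|).

Lemma control_in u s : controls T U u -> 0 <= s -> s <= T -> U (u s).
Proof. by move=> [uU _ _] s0 sT; apply: uU; rewrite /= in_itv/= s0. Qed.

Lemma solution_ae t x u xi a b : solution T f t x u xi -> t <= a -> b <= T ->
  \forall s \ae (@lebesgue_measure R), `[a, b]%classic s ->
    is_derive s (1 : R) xi (f (xi s) (u s)).
Proof.
move=> [_ _ dxi] ta bT; apply: negligibleS dxi => s /= nd h; apply: nd => sab; apply: h.
move: sab; rewrite /= !in_itv/= => /andP[h1 h2].
by rewrite (le_trans ta h1) (le_trans h2 bT).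
Qed.

(** Solutions are only assumed absolutely continuous with a derivative almost everywhere;
the Lipschitz bound comes from the mean value lemma with the ball of radius Mf
and a vanishing second component. *)
Lemma solution_lipschitz t x u xi : controls T U u -> 0 <= t -> solution T f t x u xi ->
  forall l r, t <= l -> l <= r -> r <= T -> `|xi r - xi l| <= Mf * (r - l).
Proof.
move=> cu t0 sol l r tl lr rT.
have uU s : l <= s <= r -> U (u s).
  move=> /andP[ls sr]; apply: control_in cu _ _; last exact: le_trans rT.
  exact: le_trans t0 (le_trans tl ls).
have [ac _ _] := sol.
apply/ler_addgt0Pr => e e0.
have [|||||w [Cw wxi _]] := @mean_value R n 0 l r Mf xi (fun s => f (xi s) (u s)) (fun=> 0)
  [set w | `|w.1| <= Mf] lr (abs_continuousS tl rT ac) (solution_ae sol tl rT) _ _ _ _ _ e e0.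
- by case.
- by move=> s slr; apply: f_bounded; exact: uU.
- by move=> s _; rewrite normr0.
- move=> k v w k0 k1 /= vM wM; apply: le_trans (ler_normD _ _) _.
  rewrite !normrZ (ger0_norm k0) (ger0_norm (_ : 0 <= 1 - k)) ?subr_ge0//.
  have := ler_wpM2l k0 vM; have : 0 <= 1 - k by rewrite subr_ge0.
  by move=> /ler_wpM2l /(_ _ _ wM); lra.
- by move=> s slr /=; apply: f_bounded; exact: uU.
have rl : 0 <= r - l by rewrite subr_ge0.
have := ler_normD (xi r - xi l - (r - l) *: w.1) ((r - l) *: w.1).
rewrite subrK normrZ (ger0_norm rl).
by have := ler_wpM2l rl Cw; lra.
Qed.

Definition running_cost (xi : R -> 'rV[R]_n) (u : R -> 'rV[R]_m) (s : R) := L (xi s) (u s).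

Lemma running_cost_bounded_measurable t x u xi : controls T U u -> 0 <= t ->
  solution T f t x u xi -> bounded_measurable t T ML (running_cost xi u).
Proof.
move=> cu t0 sol; split => [j|s /andP[ts sT]]; last first.
  by apply: L_bounded; apply: control_in cu _ sT; exact: le_trans ts.
apply: (measurable_running_cost L_continuous K_ge0 L_lipschitz j cu t0 (lexx T) Mf_ge0).
move=> s s' /andP[ts sT] /andP[ts' sT']; have [ss'|/ltW s's] := leP s s'.
  rewrite distrC (distrC s) (ger0_norm (_ : 0 <= s' - s)) ?subr_ge0//.
  exact: (solution_lipschitz cu t0 sol).
rewrite (ger0_norm (_ : 0 <= s - s')) ?subr_ge0//.
exact: (solution_lipschitz cu t0 sol).
Qed.

Lemma YsetP t x y : Yset T U f L t x y <-> exists u xi,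
  [/\ controls T U u, solution T f t x u xi & y = vint t T (running_cost xi u)].
Proof. by []. Qed.

Lemma Yset_bound t x y : 0 <= t -> t <= T -> Yset T U f L t x y -> `|y| <= (T - t) * ML.
Proof.
move=> t0 tT /YsetP[u [xi [cu sol ->]]].
have mq := running_cost_bounded_measurable cu t0 sol.
have := @vint_bound _ _ _ _ _ _ 0 ML tT ML_ge0 mq; rewrite scaler0 subr0; apply.
by move=> s; rewrite subr0; case: mq => _; apply.
Qed.

Lemma solution_mean t x u xi a b (C : set ('rV[R]_n * 'rV[R]_p)) (e : R) :
  controls T U u -> solution T f t x u xi -> 0 <= t -> t <= a -> a <= b -> b <= T ->
  convex_closed C ->
  (forall s, a <= s <= b -> C (f (xi s) (u s), L (xi s) (u s))) -> 0 < e ->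
  exists w, [/\ C w, `|xi b - xi a - (b - a) *: w.1| <= e &
    `|vint a b (running_cost xi u) - (b - a) *: w.2| <= e].
Proof.
move=> cu sol t0 ta ab bT cC FC e0.
have [mq bq] := bounded_measurableS ta bT (running_cost_bounded_measurable cu t0 sol).
have [ac _ _] := sol.
have uU s : a <= s <= b -> U (u s).
  move=> /andP[as_ sb]; apply: control_in cu _ _; last exact: le_trans bT.
  exact: le_trans t0 (le_trans ta as_).
apply: (@mean_value R n p a b (Num.max Mf ML) xi (fun s => f (xi s) (u s))
  (running_cost xi u) C ab (abs_continuousS ta bT ac) (solution_ae sol ta bT) mq) => //.
- by move=> s sab; rewrite le_max f_bounded//; exact: uU.
- by move=> s sab; rewrite le_max bq// orbT.
Qed.

Lemma constant_control v : U v -> controls T U (cst v).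
Proof.
move=> Uv; split; [by []|exact: bounded_cst|exact: measurable_cst].
Qed.

Lemma lebesgue_null_set1 (a : R) : (@lebesgue_measure R).-negligible [set a].
Proof. by exists [set a]; split => //; exact: lebesgue_measure_set1. Qed.

Lemma Yset_final x : 0 <= T -> Yset T U f L T x 0.
Proof.
move=> T0; have [v Uv] := U_nonempty.
have cv := constant_control Uv.
have sol : solution T f T x (cst v) (cst x).
  split => //.
    apply: (@lipschitz_abs_continuous _ _ _ _ 0) => // l r _ _ _.
    by rewrite subrr normr0 mul0r.
  apply: negligibleS (lebesgue_null_set1 T) => s /= h; apply: contrapT => sT.
  apply: h; rewrite in_itv/= => /andP[h1 h2]; exfalso; apply: sT.
  by apply/eqP; rewrite eq_le h1 h2.
apply/YsetP; exists (cst v), (cst x); split => //.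
by rewrite (vintxx (running_cost_bounded_measurable cv T0 sol)).
Qed.

(** Half of the dynamic programming principle.  The constant control is used up to and
including time b: then the glued control and trajectory agree with the first piece on all of
[s, b], and with the second one on ]b, T], which is enough for the integral. *)
Lemma prepend_constant_control v s b zeta y : U v -> 0 <= s -> s <= b -> b <= T ->
  (forall r r', `|zeta r - zeta r'| <= Mf * `|r - r'|) ->
  (forall r, s < r -> r < b -> is_derive r (1 : R) zeta (f (zeta r) v)) ->
  Yset T U f L b (zeta b) y ->
  Yset T U f L s (zeta s) (vint s b (fun r => L (zeta r) v) + y).
Proof.
move=> Uv s0 sb bT zlip zder /YsetP[u [xi [cu sol ->]]].
have b0 : 0 <= b := le_trans s0 sb.
have xlip := solution_lipschitz cu b0 sol.
pose u' r := if r <= b then v else u r.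
pose xi' r := if r <= b then zeta r else xi r.
have [ac xib der] := sol.
have cu' : controls T U u'.
  have [uU [N [Nr uN]] mu] := cu; split.
  - by move=> r; rewrite /u'; case: ifP => // _; exact: uU.
  - exists (Num.max N `|v|); split; first exact: num_real.
    move=> N'; rewrite gt_max => /andP[NN vN] r rT /=; rewrite /u'.
    by case: ifP => _; [exact: ltW|exact: (uN _ NN)].
  - have E : (`[0, T] = `[0, b] `|` `]b, T])%classic.
      apply/seteqP; split => r /=; rewrite !in_itv/=.
        by move=> /andP[r0 rT]; have [rb|br] := leP r b; [left|right]; apply/andP.
      case=> /andP[h1 h2]; apply/andP; split => //; first exact: le_trans bT.
      exact: le_trans b0 (ltW h1).
    have m1 := @completed_measurable_itv R `[0, b].
    have m2 := @completed_measurable_itv R `]b, T].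
    rewrite E; apply/(measurable_funU _ m1 m2); split.
      refine (eq_measurable_fun (T1 := @lebesgueType R)
        (T2 := g_sigma_algebraType (@open 'rV[R]_m)) (cst v) _ _) => [r|].
        by rewrite inE /= in_itv/= /u' => /andP[_ ->].
      exact: measurable_cst.
    refine (eq_measurable_fun (T1 := @lebesgueType R)
        (T2 := g_sigma_algebraType (@open 'rV[R]_m)) u _ _) => [r|].
      by rewrite inE /= in_itv/= /u' => /andP[]; rewrite ltNge => /negbTE ->.
    apply: measurable_funS mu; first exact: completed_measurable_itv.
    by rewrite E => r; right.
have lip' l r : s <= l -> l <= r -> r <= T -> `|xi' r - xi' l| <= Mf * (r - l).
  move=> sl lr rT; rewrite /xi'; case: ifPn => [rb|]; last rewrite -ltNge => br.
    by rewrite (le_trans lr rb); apply: le_trans (zlip _ _) _; rewrite ger0_norm// subr_ge0.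
  case: ifPn => [lb|]; last rewrite -ltNge => bl.
    have -> : xi r - zeta l = (xi r - xi b) + (zeta b - zeta l) by rewrite xib subrKA.
    apply: le_trans (ler_normD _ _) _.
    have h1 := xlip b r (lexx b) (ltW br) rT; have h2 := zlip b l.
    rewrite ger0_norm ?subr_ge0// in h2.
    have -> : Mf * (r - l) = Mf * (r - b) + Mf * (b - l) by ring.
    by apply: lerD.
  exact: xlip (ltW bl) lr rT.
have sol' : solution T f s (zeta s) u' xi'.
  split; [exact: (lipschitz_abs_continuous Mf_ge0 lip')|by rewrite /xi' sb|].
  have [B [mB B0 derB]] := der.
  apply: (@negligibleS _ _ _ (@lebesgue_measure R) (B `|` ([set s] `|` [set b]))); last first.
    apply: negligibleU; first by exists B; split => //; exact: B0.
    by apply: negligibleU; exact: lebesgue_null_set1.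
  move=> r /= h; apply: contrapT => /not_orP[nB /not_orP[rs rb]]; apply: h.
  rewrite in_itv/= => /andP[sr rT].
  have {rs}sr : s < r by rewrite lt_neqAle sr andbT eq_sym; exact/eqP.
  have [rltb|br] := ltP r b.
    rewrite {2}/xi' /u' (ltW rltb).
    apply: near_eq_is_derive (zder r sr rltb); near=> r'.
    rewrite /xi'; have -> // : r' <= b.
    by apply: ltW; near: r'; exact: lt_nbhsl.
  have {rb}br : b < r by rewrite lt_neqAle br andbT eq_sym; exact/eqP.
  rewrite {2}/xi' /u' leNgt br /=.
  apply: (@near_eq_is_derive _ _ _ xi).
    near=> r'; rewrite /xi'; have -> // : (r' <= b) = false.
    by apply/negbTE; rewrite -ltNge; near: r'; exact: lt_nbhsr.
  apply: contrapT => nder; apply: nB; apply: derB => /= h.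
  by apply: nder; apply: h; rewrite in_itv/= (ltW br).
apply/YsetP; exists u', xi'; split => //.
have mq' := running_cost_bounded_measurable cu' s0 sol'.
rewrite (vint_cat sb bT mq'); congr (_ + _).
  by apply: vint_eq => r /andP[_ rb]; rewrite /running_cost /xi' /u' rb.
apply: vint_oc_eq bT (running_cost_bounded_measurable cu b0 sol)
  (bounded_measurableS sb (lexx T) mq') _ => r /andP[br _].
by rewrite /running_cost /xi' /u' leNgt br.
Unshelve. all: by end_near. Qed.

(** * Convexified velocities *)

Notation Y := (Yset T U f L).

Definition hull (x0 : 'rV[R]_n) : set ('rV[R]_n * 'rV[R]_p) :=
  smallest (@convex_set R ('rV[R]_n * 'rV[R]_p)%type) [set (f x0 u, L x0 u) | u in U].

Lemma hull_gen x0 u : U u -> hull x0 (f x0 u, L x0 u).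
Proof. by move=> Uu A [_ GA]; apply: GA; exists u. Qed.

Lemma hull_convex x0 : convex_closed (hull x0).
Proof.
move=> k v w k0 k1 hv hw A [cA GA].
have vA : v \in A by rewrite inE; apply: hv.
have wA : w \in A by rewrite inE; apply: hw.
by have := cA v w (Itv01 k0 k1) vA wA; rewrite inE.
Qed.

Lemma hull_min x0 (P : set ('rV[R]_n * 'rV[R]_p)) : convex_closed P ->
  (forall u, U u -> P (f x0 u, L x0 u)) -> hull x0 `<=` P.
Proof.
move=> cP GP q; apply; split; last by move=> _ [u Uu <-]; exact: GP.
move=> v w k; rewrite !inE => Pv Pw; exact: cP.
Qed.

Lemma hull_sub_FLplus x0 : hull x0 `<=` FLplus U f L x0.
Proof. exact: subset_closure. Qed.

Lemma FLplus_approx x0 q (d : R) : 0 < d -> FLplus U f L x0 q ->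
  exists q', [/\ hull x0 q', `|q.1 - q'.1| <= d & `|q.2 - q'.2| <= d].
Proof.
move=> d0 /(_ (ball q d) (nbhsx_ballx _ _ d0)) [q' [hq' [b1 b2]]].
by exists q'; split => //; apply: ltW; [move: b1|move: b2]; rewrite mx_norm_ball.
Qed.

Lemma hull_bounded x0 q : hull x0 q -> `|q.1| <= Mf /\ `|q.2| <= ML.
Proof.
apply: (@hull_min x0 [set q | `|q.1| <= Mf /\ `|q.2| <= ML]); last first.
  by move=> u Uu; split; [exact: f_bounded|exact: L_bounded].
move=> k v w k0 k1 /= [v1 v2] [w1 w2].
have k1' : 0 <= 1 - k by rewrite subr_ge0.
split; apply: le_trans (ler_normD _ _) _; rewrite !normrZ (ger0_norm k0) (ger0_norm k1').
  by have := ler_wpM2l k0 v1; have := ler_wpM2l k1' w1; lra.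
by have := ler_wpM2l k0 v2; have := ler_wpM2l k1' w2; lra.
Qed.

Lemma FLplus_bounded x0 q : FLplus U f L x0 q -> `|q.1| <= Mf /\ `|q.2| <= ML.
Proof.
move=> Fq; split; apply/ler_addgt0Pr => e e0;
  have [q' [hq' h1 h2]] := FLplus_approx e0 Fq; have [b1 b2] := hull_bounded hq'.
  by have := ler_normD (q.1 - q'.1) q'.1; rewrite subrK; lra.
by have := ler_normD (q.2 - q'.2) q'.2; rewrite subrK; lra.
Qed.

(** The other half of the dynamic programming principle, with an estimate of the first
piece by an element of FLplus at a nearby point xh.  Along the piece the state stays
within rho of xh, so the pairs (f, L) stay within K rho of the hull at xh, which is a
convex condition.  The slack e comes from the mean value lemma. *)
Lemma Yset_split t b x y : 0 <= t -> t <= b -> b <= T -> Y t x y ->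
  exists x' c y', [/\ y = c + y', Y b x' y' &
    forall xh rho e, `|x - xh| + Mf * (b - t) <= rho -> 0 < e ->
      exists q, [/\ FLplus U f L xh q,
        `|x' - x - (b - t) *: q.1| <= (b - t) * (K * rho) + e &
        `|c - (b - t) *: q.2| <= (b - t) * (K * rho) + e]].
Proof.
move=> t0 tb bT /YsetP[u [xi [cu sol ->]]].
have mq := running_cost_bounded_measurable cu t0 sol.
have xlip := solution_lipschitz cu t0 sol.
have [ac xit _] := sol.
exists (xi b), (vint t b (running_cost xi u)), (vint b T (running_cost xi u)); split.
- exact: vint_cat tb bT mq.
- apply/YsetP; exists u, xi; split => //; split => //.
    exact: abs_continuousS ac.
  exact: solution_ae sol tb (lexx T).
move=> xh rho e rhoP e0.
have bt0 : 0 <= b - t by rewrite subr_ge0.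
pose C : set ('rV[R]_n * 'rV[R]_p) := [set w | exists q, [/\ hull xh q,
  `|w.1 - q.1| <= K * rho & `|w.2 - q.2| <= K * rho]].
have cC : convex_closed C.
  move=> k v w k0 k1 [q [hq v1 v2]] [r [hr w1 w2]].
  have k1' : 0 <= 1 - k by rewrite subr_ge0.
  exists (k *: q + (1 - k) *: r); split => /=.
  - exact: hull_convex.
  - have -> : k *: v.1 + (1 - k) *: w.1 - (k *: q.1 + (1 - k) *: r.1) =
       k *: (v.1 - q.1) + (1 - k) *: (w.1 - r.1) by rewrite !scalerBr opprD addrACA.
    apply: le_trans (ler_normD _ _) _; rewrite !normrZ (ger0_norm k0) (ger0_norm k1').
    by have := ler_wpM2l k0 v1; have := ler_wpM2l k1' w1; lra.
  - have -> : k *: v.2 + (1 - k) *: w.2 - (k *: q.2 + (1 - k) *: r.2) =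
       k *: (v.2 - q.2) + (1 - k) *: (w.2 - r.2) by rewrite !scalerBr opprD addrACA.
    apply: le_trans (ler_normD _ _) _; rewrite !normrZ (ger0_norm k0) (ger0_norm k1').
    by have := ler_wpM2l k0 v2; have := ler_wpM2l k1' w2; lra.
have FC s : t <= s <= b -> C (f (xi s) (u s), L (xi s) (u s)).
  move=> /andP[ts sb]; have sT := le_trans sb bT.
  have Us : U (u s) by apply: control_in cu _ sT; exact: le_trans ts.
  have xs : `|xi s - xh| <= rho.
    have -> : xi s - xh = (xi s - xi t) + (x - xh) by rewrite xit subrKA.
    apply: le_trans (ler_normD _ _) _; have xst := xlip t s (lexx t) ts sT.
    have bst : Mf * (s - t) <= Mf * (b - t) by rewrite ler_wpM2l// lerD2r.
    lra.
  exists (f xh (u s), L xh (u s)); split => /=; first exact: hull_gen.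
    by apply: le_trans (f_lipschitz _ _ Us) _; rewrite ler_wpM2l.
  by apply: le_trans (L_lipschitz _ _ Us) _; rewrite ler_wpM2l.
have [w [[q [hq q1 q2]] w1 w2]] := solution_mean cu sol t0 (lexx t) tb bT cC FC e0.
exists q; split; first exact: hull_sub_FLplus.
  have -> : xi b - x - (b - t) *: q.1 = (xi b - xi t - (b - t) *: w.1) + (b - t) *: (w.1 - q.1).
    by rewrite xit scalerBr subrKA.
  apply: le_trans (ler_normD _ _) _; rewrite normrZ (ger0_norm bt0) addrC.
  by apply: lerD => //; exact: ler_wpM2l.
have -> : vint t b (running_cost xi u) - (b - t) *: q.2 =
  (vint t b (running_cost xi u) - (b - t) *: w.2) + (b - t) *: (w.2 - q.2).
  by rewrite scalerBr subrKA.
apply: le_trans (ler_normD _ _) _; rewrite normrZ (ger0_norm bt0) addrC.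
by apply: lerD => //; exact: ler_wpM2l.
Qed.

(** From any state near x0 the pair q can be followed for a time theta: the state moves by
about theta q.1, and the cost by about theta q.2.  The future is quantified over as a set of
attainable costs, so that successive pieces compose without mentioning controls.
The radius r bounds the distance to x0 during the whole motion; the error rate
K r is the one caused by freezing the state at x0, and d is extra slack. *)
Definition steerable (x0 : 'rV[R]_n) (d : R) (q : 'rV[R]_n * 'rV[R]_p) :=
  forall r theta s x, 0 <= theta -> 0 <= s -> s + theta <= T -> K * theta <= 2^-1 ->
    `|x - x0| + Mf * theta <= r ->
    exists x', [/\ `|x' - x| <= Mf * theta, `|x' - x - theta *: q.1| <= theta * (K * r + d) &
      forall y, Y (s + theta) x' y ->
        exists c, `|c - theta *: q.2| <= theta * (K * r + d) /\ Y s x (c + y)].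

Lemma steerable_gen x0 d u : 0 <= d -> U u -> steerable x0 d (f x0 u, L x0 u).
Proof.
move=> d0 Uu r theta s x th0 s0 sT Kth xr /=.
have sth : s <= s + theta by rewrite lerDl.
have [|||zeta [zs zlip zder zint]] :=
  @picard R n (fun z => f z u) Mf K x s (s + theta) K_ge0 _ _ sth _.
- by move=> y z; exact: f_lipschitz.
- by move=> y; exact: f_bounded.
- by rewrite addrC addKr.
have thE : s + theta - s = theta by rewrite addrC addKr.
have r0 : 0 <= K * r + d.
  rewrite addr_ge0// mulr_ge0//; apply: le_trans xr; rewrite addr_ge0// mulr_ge0//.
have near0 q : s <= q <= s + theta -> `|zeta q - x0| <= r.
  move=> /andP[sq qs]; have -> : zeta q - x0 = (zeta q - zeta s) + (x - x0) by rewrite zs subrKA.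
  apply: le_trans (ler_normD _ _) _; apply: le_trans xr; rewrite addrC lerD2l.
  apply: le_trans (zlip _ _) _; rewrite ler_wpM2l// ger0_norm ?subr_ge0//; lra.
have Kr : K * r <= K * r + d by rewrite lerDl.
exists (zeta (s + theta)); rewrite -zs; split.
- by apply: le_trans (zlip _ _) _; rewrite thE ger0_norm.
- have mg : bounded_measurable s (s + theta) Mf (fun q => f (zeta q) u).
    apply: (@lipschitz_bounded_measurable _ _ _ _ _ _ (K * Mf)) => [q q'|q]; last exact: f_bounded.
    by apply: le_trans (f_lipschitz _ _ Uu) _; rewrite -mulrA ler_wpM2l.
  rewrite zint; have := vint_bound (v := f x0 u) sth r0 mg; rewrite thE; apply => q qs.
  by apply: le_trans (f_lipschitz _ _ Uu) _; apply: le_trans Kr; rewrite ler_wpM2l// near0.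
move=> y Yy; exists (vint s (s + theta) (fun q => L (zeta q) u)); split.
  have mg : bounded_measurable s (s + theta) ML (fun q => L (zeta q) u).
    apply: (@lipschitz_bounded_measurable _ _ _ _ _ _ (K * Mf)) => [q q'|q]; last exact: L_bounded.
    by apply: le_trans (L_lipschitz _ _ Uu) _; rewrite -mulrA ler_wpM2l.
  have := vint_bound (v := L x0 u) sth r0 mg; rewrite thE; apply => q qs.
  by apply: le_trans (L_lipschitz _ _ Uu) _; apply: le_trans Kr; rewrite ler_wpM2l// near0.
exact: (prepend_constant_control Uu s0 sth sT zlip zder Yy).
Qed.

(** Follow the first pair during k theta, then the second one during (1 - k) theta: the
errors add up to the error allowed for the combination, as they are proportional
to time.  The radius r is shared, since the whole motion stays in it. *)
Lemma steerable_convex x0 d : convex_closed (steerable x0 d).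
Proof.
move=> k v w k0 k1 Sv Sw r theta s x th0 s0 sT Kth xr.
have k1' : 0 <= 1 - k by rewrite subr_ge0.
have kth0 : 0 <= k * theta by exact: mulr_ge0.
have kth1 : 0 <= (1 - k) * theta by exact: mulr_ge0.
have thE : k * theta + (1 - k) * theta = theta by ring.
have Mk : Mf * theta = Mf * (k * theta) + Mf * ((1 - k) * theta) by ring.
have Mk0 : 0 <= Mf * (k * theta) by exact: mulr_ge0.
have Mk1 : 0 <= Mf * ((1 - k) * theta) by exact: mulr_ge0.
have Kk : K * theta = K * (k * theta) + K * ((1 - k) * theta) by ring.
have Kk0 : 0 <= K * (k * theta) by exact: mulr_ge0.
have Kk1 : 0 <= K * ((1 - k) * theta) by exact: mulr_ge0.
have [|||x1 [x11 x12 x13]] := Sv r (k * theta) s x kth0 s0 _ _ _; [lra..|].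
have [||||x2 [x21 x22 x23]] := Sw r ((1 - k) * theta) (s + k * theta) x1 kth1 _ _ _ _.
- lra.
- lra.
- lra.
- have := ler_normD (x1 - x) (x - x0); rewrite subrKA; lra.
have split_err (V : normedModType R) (a b c e : V) (E : R) :
    `|a - (k * theta) *: b| <= k * theta * E -> `|c - ((1 - k) * theta) *: e| <= (1 - k) * theta * E ->
    `|a + c - theta *: (k *: b + (1 - k) *: e)| <= theta * E.
  move=> h1 h2; have -> : a + c - theta *: (k *: b + (1 - k) *: e) =
     (a - (k * theta) *: b) + (c - ((1 - k) * theta) *: e).
    by rewrite scalerDr !scalerA (mulrC theta k) (mulrC theta (1 - k)) opprD addrACA.
  apply: le_trans (ler_normD _ _) _; apply: le_trans (lerD h1 h2) _.
  by rewrite -mulrDl thE.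
have x2E : x2 - x = (x1 - x) + (x2 - x1) by rewrite [RHS]addrC subrKA.
exists x2; split.
- by rewrite x2E; apply: le_trans (ler_normD _ _) _; lra.
- by rewrite x2E; exact: split_err.
move=> y; have -> : s + theta = s + k * theta + (1 - k) * theta by rewrite -addrA thE.
move=> /x23[c2 [c21 /x13[c1 [c11 c12]]]]; exists (c1 + c2).
by split; [exact: split_err|rewrite -addrA].
Qed.

Lemma steerable_FLplus x0 d q : 0 < d -> FLplus U f L x0 q -> steerable x0 d q.
Proof.
move=> d0 Fq r theta s x th0 s0 sT Kth xr.
have [q' [hq' h1 h2]] := FLplus_approx d0 Fq.
have st : steerable x0 0 q'.
  by apply: hull_min hq'; [exact: steerable_convex|move=> u; exact: steerable_gen].
have [x' [x1 x2 x3]] := st r theta s x th0 s0 sT Kth xr.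
have err (V : normedModType R) (a b c : V) : `|a - theta *: b| <= theta * (K * r + 0) ->
    `|c - b| <= d -> `|a - theta *: c| <= theta * (K * r + d).
  move=> h3 h4; have -> : a - theta *: c = (a - theta *: b) - theta *: (c - b).
    by rewrite scalerBr opprB addrA subrK.
  apply: le_trans (ler_normB _ _) _; rewrite normrZ (ger0_norm th0).
  have := ler_wpM2l th0 h4; lra.
exists x'; split => //; first exact: err h1.
move=> y /x3[c [c1 c2]]; exists c; split => //; exact: err h2.
Qed.

End System.

(** * Lattices and Pareto elements *)

Section ParetoFacts.
Context {R : realType}.

Lemma latticeD (h x y : R) : lattice h x -> lattice h y -> lattice h (x + y).
Proof. by move=> [a _ <-] [b _ <-]; exists (a + b) => //; rewrite intrD mulrDl. Qed.

Lemma latticeN (h x : R) : lattice h x -> lattice h (- x).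
Proof. by move=> [a _ <-]; exists (- a) => //; rewrite intrN mulNr. Qed.

Lemma latticeB (h x y : R) : lattice h x -> lattice h y -> lattice h (x - y).
Proof. by move=> lx ly; apply: latticeD => //; exact: latticeN. Qed.

Lemma lattice_gap (h x : R) : 0 < h -> lattice h x -> 0 < x -> h <= x.
Proof.
move=> h0 [a _ <-]; rewrite pmulr_lgt0// => a0.
have : (0 < a)%R by rewrite -(ltr_int R).
by rewrite gtz0_ge1 => a1; rewrite ler_peMl ?(ltW h0)// (ler_int R 1).
Qed.

Lemma lattice_round (h x : R) : 0 < h -> exists2 y, lattice h y & `|y - x| <= h / 2.
Proof.
move=> h0; pose k := Num.floor (x / h + 2^-1).
exists (k%:~R * h); first by exists k.
have /andP[k1 k2] := floor_itv (x / h + 2^-1).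
rewrite -/k in k1 k2; rewrite intrD in k2.
have xh : x = x / h * h by rewrite divfK ?gt_eqF.
rewrite [in X in `|_ - X|]xh -mulrBl normrM (gtr0_norm h0) mulrC ler_pM2l//.
by rewrite ler_norml; apply/andP; split; lra.
Qed.

Variable p : nat.
Implicit Types (S : set 'rV[R]_p) (y z w : 'rV[R]_p).

Lemma vlatticeD h y z : vlattice p h y -> vlattice p h z -> vlattice p h (y + z).
Proof. by move=> ly lz j; rewrite mxE; apply: latticeD. Qed.

Lemma vlatticeB h y z : vlattice p h y -> vlattice p h z -> vlattice p h (y - z).
Proof. by move=> ly lz j; rewrite !mxE; apply: latticeB. Qed.

Lemma vlattice_round h y : 0 < h -> exists2 z, vlattice p h z & `|z - y| <= h / 2.
Proof.
move=> h0; have /choice [z zP] : forall j, exists t, lattice h t /\ `|t - y ord0 j| <= h / 2.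
  by move=> j; have [t h1 h2] := lattice_round (y ord0 j) h0; exists t.
exists (\row_j z j) => [j|]; first by rewrite mxE; case: (zP j).
apply: row_norm_le => [|j]; first by rewrite divr_ge0// ltW.
by rewrite !mxE; case: (zP j).
Qed.

Lemma orthantD y z : orthant y -> orthant z -> orthant (y + z).
Proof. by move=> oy oz j; rewrite mxE addr_ge0. Qed.

Lemma msum1P y z : Defs.msum [set y] orthant z <-> orthant (z - y).
Proof.
split=> [[_ -> [v ov <-]]|oz]; first by rewrite addrC addKr.
by exists y => //; exists (z - y) => //; rewrite addrC subrK.
Qed.

(** Two different comparable lattice points differ by at least h in some coordinate, so the sum
of the coordinates drops by at least h. *)
Lemma pareto_lattice_descent h S y : 0 < h -> S `<=` vlattice p h -> S y -> ~ pareto S y ->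
  exists y2, [/\ S y2, orthant (y - y2) &
    \sum_j y2 ord0 j + h <= \sum_j y ord0 j].
Proof.
move=> h0 Sl Sy npy.
have [y2 [Sy2 y2y /msum1P oy]] :
    exists y2, [/\ S y2, y2 <> y & Defs.msum [set y2] orthant y].
  by apply: contrapT => ny; apply: npy; split.
exists y2; split => //.
have ly : vlattice p h (y - y2) by apply: vlatticeB; apply: Sl.
have [j jy] : exists j, y2 ord0 j != y ord0 j.
  apply: contrapT => nj; apply: y2y; apply/rowP => j.
  by apply: contrapT => /eqP nej; apply: nj; exists j.
have gap : h <= y ord0 j - y2 ord0 j.
  apply: lattice_gap => //; first by have := ly j; rewrite !mxE.
  by have := oy j; rewrite !mxE subr_ge0 subr_gt0 lt_neqAle jy.
rewrite (bigD1 j)//= [leRHS](bigD1 j)//= addrAC; apply: lerD; first lra.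
by apply: ler_sum => i _; have := oy i; rewrite !mxE subr_ge0.
Qed.

(** The descent from y stops because the sums of coordinates are bounded below. *)
Lemma pareto_lattice_dominates h S (b : R) y : 0 < h -> S `<=` vlattice p h ->
  (forall z, S z -> forall j, b <= z ord0 j) -> S y ->
  exists w, [/\ pareto S w, vlattice p h (y - w) & orthant (y - w)].
Proof.
move=> h0 Sl Sb; pose c := \sum_(j < p) b.
have Sc z : S z -> c <= \sum_j z ord0 j by move=> Sz; apply: ler_sum => j _; exact: Sb.
have [N yN] : exists N : nat, \sum_j y ord0 j - c <= N%:R * h.
  exists (Num.truncn ((\sum_j y ord0 j - c) / h)).+1.
  by rewrite -ler_pdivrMr// ltW// truncnS_gt.
elim: N y yN => [|N IH] y yN Sy; (have [py|npy] := pselect (pareto S y);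
  first by exists y; split=> // j; rewrite !mxE subrr//; exists 0; rewrite // mul0r);
  have [y2 [Sy2 oy sy]] := pareto_lattice_descent h0 Sl Sy npy.
  by have := Sc y2 Sy2; move: yN; rewrite mul0r; lra.
have y2N : \sum_j y2 ord0 j - c <= N%:R * h.
  by move: yN; rewrite -natr1 mulrDl mul1r; lra.
have [w [pw lw ow]] := IH y2 y2N Sy2; exists w.
have -> : y - w = (y - y2) + (y2 - w) by rewrite subrKA.
split => //; last exact: orthantD.
by apply: vlatticeD => //; apply: vlatticeB; apply: Sl.
Qed.

(** Minimize the sum of the coordinates over the points of S below y: a smaller point of S
would have a smaller sum. *)
Lemma pareto_compact_dominates S y : compact S -> S y ->
  exists w, pareto S w /\ orthant (y - w).
Proof.
move=> cS Sy; pose A := S `&` [set z | orthant (y - z)].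
have cA : compact A.
  apply: compact_closedI => //.
  have -> : [set z | orthant (y - z)] = \bigcap_(j in [set: 'I_p]) [set z : 'rV[R]_p | z ord0 j <= y ord0 j].
    apply/seteqP; split=> z /=; first by move=> oz j _; have := oz j; rewrite !mxE subr_ge0.
    by move=> oz j; rewrite !mxE subr_ge0; exact: oz.
  apply: closed_bigI => j _.
  have /continuous_closedP cj : continuous (fun z : 'rV[R]_p => z ord0 j).
    by move=> z; exact: coord_continuous.
  exact: (cj [set t | t <= y ord0 j] (@closed_le _ _)).
have A0 : A !=set0 by exists y; split => // j; rewrite !mxE subrr.
have [|w] := EVT_min_rV A0 cA (f := fun z => \sum_j z ord0 j).
  apply: continuous_subspaceT.
  refine (@continuous_big _ _ +%R 0 xpredT _ _ (index_enum 'I_p)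
    (fun j (z : 'rV[R]_p) => z ord0 j) _) => [|j _ z].
    exact: add_continuous.
  exact: coord_continuous.
rewrite inE => -[Sw ow] wmin; exists w; split => //; split => //.
case=> y2 [Sy2 y2w /msum1P o2]; apply: y2w.
have A2 : A y2.
  split => //=; have -> : y - y2 = (y - w) + (w - y2) by rewrite subrKA.
  exact: orthantD.
have := wmin y2 (mem_set A2); rewrite -subr_le0 -sumrB => s0.
apply/rowP => j; have oj k : 0 <= w ord0 k - y2 ord0 k by have := o2 k; rewrite !mxE.
apply/eqP; rewrite eq_sym -subr_eq0; apply/eqP.
apply: (@psumr_eq0P _ _ predT (fun k => w ord0 k - y2 ord0 k)) => //.
by apply/eqP; rewrite eq_le s0 sumr_ge0.
Qed.

End ParetoFacts.

(** * The scheme for a fixed pair (eps, h) *)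

Section Discrete.
Context {R : realType} {n m p : nat}.
Variables (T : R) (U : set 'rV[R]_m).
Variables (f : 'rV[R]_n -> 'rV[R]_m -> 'rV[R]_n)
          (L : 'rV[R]_n -> 'rV[R]_m -> 'rV[R]_p).
Variables (Mf ML Kf KL MbarL : R).
Hypotheses (T_gt0 : 0 < T) (Mf_gt0 : 0 < Mf) (ML_ge0 : 0 <= ML) (Kf_gt0 : 0 < Kf)
  (KL_ge0 : 0 <= KL) (MbarL_gt : ML < MbarL)
  (f_bounded : forall x u, U u -> `|f x u| <= Mf)
  (L_bounded : forall x u, U u -> `|L x u| <= ML).
Variables (V0 : R -> R -> R -> 'rV[R]_n -> set 'rV[R]_p) (eps h : R).
Hypotheses (eps_gt0 : 0 < eps) (h_gt0 : 0 < h) (h_eps : 2 * h < eps - 2 * h)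
  (V0_initial : initial_map T MbarL h (V0 eps h))
  (MbarL_dominates : eps * ML + alpha Mf ML Kf KL eps h <= (eps - 2 * h) * MbarL).

Let M := Num.max 1 (Num.max Mf ML).
Let K := Num.max Kf KL.
Let cut := T - M * eps - h.
Notation al := (alpha Mf ML Kf KL eps h).
Notation V k := (Defs.approx T U f L Mf ML Kf KL V0 eps h k).
Notation W := (final_approx T U f L Mf ML Kf KL V0 eps h).
Notation next t := (`[t + eps - 2 * h, t + eps + 2 * h]%classic `&` lattice h).

Let M_ge1 : 1 <= M. Proof. by rewrite /M le_max lexx. Qed.
Let Mf_le : Mf <= M. Proof. by rewrite /M !le_max lexx orbT. Qed.
Let ML_le : ML <= M. Proof. by rewrite /M !le_max lexx !orbT. Qed.
Let K_gt0 : 0 < K. Proof. by rewrite /K lt_max Kf_gt0. Qed.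
Let MbarL_ge0 : 0 <= MbarL. Proof. by rewrite (le_trans ML_ge0)// ltW. Qed.

Lemma alphaE : al = 2 * h + eps * h * K + eps ^+ 2 * K * M.
Proof. by []. Qed.

Lemma alpha_gt0 : 0 < al.
Proof.
have M0 : 0 <= M by exact: le_trans M_ge1.
have h1 : 0 <= eps * h * K by rewrite !mulr_ge0// ltW.
have h2 : 0 <= eps ^+ 2 * K * M by rewrite !mulr_ge0// ?exprn_ge0// ltW.
by rewrite alphaE; have := h_gt0; lra.
Qed.

Lemma timegridP t : timegrid T h t <-> [/\ lattice h t, - h <= t & t <= T + h].
Proof.
have hh : - h <= h by have := h_gt0; lra.
have T0 := T_gt0; split.
  case=> -[a + [b + <-]] lt; rewrite /= !in_itv/= => /andP[a0 aT] /andP[b0 bT].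
  by split => //; lra.
case=> lt ht tT; split => //.
exists (Num.max 0 (Num.min T t)).
  by rewrite /= in_itv/= le_max lexx/= ge_max ltW//= ge_min lexx.
exists (t - Num.max 0 (Num.min T t)); last by rewrite addrC subrK.
rewrite /= in_itv/=; rewrite /Num.max /Num.min.
by case: ifP; case: ifP => ? ?; apply/andP; split; lra.
Qed.

(** M >= 1 keeps t + eps + 2 h within the time grid when t is below the cut. *)
Lemma next_timegrid t s : timegrid T h t -> t < cut -> next t s ->
  [/\ timegrid T h s, t + (eps - 2 * h) <= s & s <= t + eps + 2 * h].
Proof.
move=> /timegridP[lt ht tT] tcut [+ ls]; rewrite /= in_itv/= => /andP[s1 s2].
have Me : eps <= M * eps by rewrite ler_peMl// ltW.
have ? := h_gt0; have ? := h_eps; rewrite /cut in tcut.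
by split; [apply/timegridP; split => //|..]; lra.
Qed.

(** Backward induction over grid times: a step from t leads to times that are larger by at
least eps - 2 h. *)
Lemma grid_time_ind (P : R -> Prop) :
  (forall t, timegrid T h t -> cut <= t -> P t) ->
  (forall t, timegrid T h t -> t < cut -> (forall s, next t s -> P s) -> P t) ->
  forall t, timegrid T h t -> P t.
Proof.
move=> P0 Pstep.
have d0 : 0 < eps - 2 * h by have := h_gt0; have := h_eps; lra.
have ind (j : nat) t : timegrid T h t -> cut - j%:R * (eps - 2 * h) <= t -> P t.
  elim: j t => [|j IH] t gt tj; first by apply: P0 => //; move: tj; rewrite mul0r subr0.
  have [ct|tc] := leP cut t; first exact: P0.
  apply: Pstep => // s ns; have [gs s1 s2] := next_timegrid gt tc ns.
  by apply: IH => //; move: tj; rewrite -natr1 mulrDl mul1r; lra.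
move=> t gt; have /timegridP[_ ht _] := gt.
pose j := (Num.truncn ((cut + h) / (eps - 2 * h))).+1.
apply: (ind j) => //.
have : cut + h <= j%:R * (eps - 2 * h) by rewrite -ler_pdivrMr// ltW// truncnS_gt.
lra.
Qed.

Lemma approx_step k t x : t < cut -> V k.+1 t x =
  pareto (\bigcup_(q in FLplus U f L x)
      Defs.msum (closed_ball (eps *: q.2) al `&` vlattice p h)
        (\bigcup_(s in next t)
         \bigcup_(y in closed_ball (x + eps *: q.1) al `&` vlattice n h) V k s y)).
Proof. by move=> tc; rewrite /Defs.approx /= {1}/Defs.step -/M -/cut tc. Qed.

Lemma approx_terminal k t x : cut <= t -> V k t x = V0 eps h t x.
Proof.
move=> ct; elim: k => // k <-; rewrite /Defs.approx /= {1}/Defs.step -/M -/cut.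
by rewrite ltNge ct.
Qed.

(** After j iterations the values at times at least cut - j (eps - 2 h) are final. *)
Lemma approx_stabilizes : exists N : nat, stable_from T U f L Mf ML Kf KL V0 eps h N.
Proof.
have d0 : 0 < eps - 2 * h by have := h_gt0; have := h_eps; lra.
have ind (j : nat) k t : (j <= k)%N -> timegrid T h t -> cut - j%:R * (eps - 2 * h) <= t ->
    forall x, vlattice n h x -> V k t x = V j t x.
  elim: j k t => [|j IH] k t jk gt tj x lx.
    by rewrite !approx_terminal//; move: tj; rewrite mul0r subr0.
  have [ct|tc] := leP cut t; first by rewrite !approx_terminal.
  case: k jk => // k; rewrite ltnS => jk; rewrite !approx_step//.
  congr pareto; apply: eq_bigcupr => q _; congr (Defs.msum _ _).
  apply: eq_bigcupr => s ns; apply: eq_bigcupr => y [_ ly].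
  have [gs s1 s2] := next_timegrid gt tc ns.
  by apply: IH => //; move: tj; rewrite -natr1 mulrDl mul1r; lra.
pose j := (Num.truncn ((cut + h) / (eps - 2 * h))).+1.
have jP : cut + h <= j%:R * (eps - 2 * h) by rewrite -ler_pdivrMr// ltW// truncnS_gt.
exists j => k jk t x gt lx; apply: ind => //.
by have /timegridP[_ ht _] := gt; lra.
Qed.

Lemma final_stable : stable_from T U f L Mf ML Kf KL V0 eps h
  (last_index T U f L Mf ML Kf KL V0 eps h).
Proof.
have [N sN] := approx_stabilizes.
pose P k := `[< stable_from T U f L Mf ML Kf KL V0 eps h k >].
have exP : exists k, P k by exists N; apply/asboolP.
case: (ex_minnP exP) => N0 /asboolP sN0 minN0.
have : [set N | stable_from T U f L Mf ML Kf KL V0 eps h N /\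
    forall N', stable_from T U f L Mf ML Kf KL V0 eps h N' -> (N <= N')%N] !=set0.
  by exists N0; split => // N' sN'; apply: minN0; apply/asboolP.
by move=> /(xgetPex 0%N)[].
Qed.

Lemma final_terminal t x : cut <= t -> W t x = V0 eps h t x.
Proof. exact: approx_terminal. Qed.

Definition candidates t x : set 'rV[R]_p :=
  \bigcup_(q in FLplus U f L x)
      Defs.msum (closed_ball (eps *: q.2) al `&` vlattice p h)
        (\bigcup_(s in next t)
         \bigcup_(y in closed_ball (x + eps *: q.1) al `&` vlattice n h) W s y).

Lemma final_step t x : timegrid T h t -> vlattice n h x -> t < cut ->
  W t x = pareto (candidates t x).
Proof.
move=> gt lx tc; rewrite /final_approx.
by rewrite -(final_stable (leqnSn _) gt lx) approx_step.
Qed.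

Lemma candidatesP t x w : candidates t x w <-> exists q c s y w',
  [/\ FLplus U f L x q, `|eps *: q.2 - c| <= al /\ vlattice p h c, next t s,
   `|x + eps *: q.1 - y| <= al /\ vlattice n h y & W s y w' /\ w = c + w'].
Proof.
rewrite /candidates; split.
  move=> [q Fq [c [+ lc] [w' [s ns [y [+ ly] Ww']] <-]]].
  rewrite !closed_ballE ?alpha_gt0//= /closed_ball_/= => cq yq.
  by exists q, c, s, y, w'; split.
move=> [q [c [s [y [w' [Fq [cq lc] ns [yq ly] [Ww ->]]]]]]].
exists q => //; exists c; first by split => //; rewrite closed_ballE ?alpha_gt0.
exists w' => //; exists s => //; exists y => //.
by split => //; rewrite closed_ballE ?alpha_gt0.
Qed.

Lemma in_Hgrid (t t' : R) (x x' : 'rV[R]_n) (z z' : 'rV[R]_p) : timegrid T h t -> vlattice n h x -> vlattice p h z ->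
  0 <= t' -> t' <= T -> (forall j, - ((T - t') * MbarL) <= z' ord0 j) ->
  `|t - t'| <= h -> `|x - x'| <= h -> `|z - z'| <= h -> Hgrid T MbarL h (t, x, z).
Proof.
move=> /timegridP[lt _ _] lx lz t'0 t'T z'M tt xx zz; split; last by split.
exists (t', x', z').
  split; first by rewrite /= in_itv/= t'0.
  by apply/msum1P => j; rewrite !mxE/= opprK -lerBlDr add0r; exact: z'M.
exists (t - t', x - x', z - z').
  by rewrite closed_ballE// /closed_ball_/= sub0r normrN !prod_normE/= !ge_max tt xx.
rewrite -[LHS]/(t' + (t - t'), x' + (x - x'), z' + (z - z')).
by congr (_, _, _); rewrite addrC subrK.
Qed.

Lemma Hgrid_lower t (x : 'rV[R]_n) (z : 'rV[R]_p) : Hgrid T MbarL h (t, x, z) ->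
  forall j, - ((T + h - t) * MbarL) - h <= z ord0 j.
Proof.
case=> -[[[t' x'] z'] [/= + /msum1P zo] [[[bt bx] bz] + [<- _ <-]]] _ j.
rewrite in_itv/= => /andP[t'0 t'T].
rewrite closed_ballE// /closed_ball_/= sub0r normrN !prod_normE/= !ge_max.
move=> /andP[/andP[bth _] bzh].
have := zo j; rewrite !mxE/= opprK => zj.
have := le_trans (row_norm_coord bz j) bzh; rewrite ler_norml => /andP[b1 _].
move: bth; rewrite ler_norml => /andP[_ bt1].
have : (T - t') * MbarL <= (T + h - (t' + bt)) * MbarL by apply: ler_wpM2r => //; lra.
lra.
Qed.

(** The lower bound is the one of the initial epigraph.  It is preserved by a step exactly
because eps ML + alpha <= (eps - 2 h) MbarL: the most negative cost of a step is
at least the increase of the bound over a time eps - 2 h. *)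
Lemma final_in_lattice_bounded t : timegrid T h t -> forall x w, vlattice n h x -> W t x w ->
  vlattice p h w /\ forall j, - ((T + h - t) * MbarL) - h <= w ord0 j.
Proof.
have [V0fin V0grid] := V0_initial.
move: t; apply: grid_time_ind => [t gt ct x w lx|t gt tc IH x w lx].
  rewrite final_terminal// => V0w; split; first by apply: (V0fin t x gt lx).1.
  apply: (@Hgrid_lower t x w); rewrite -V0grid; split => //=.
  exists w => //; exists 0; last by rewrite addr0.
  by split => j; rewrite mxE//; exists 0; rewrite // mul0r.
rewrite final_step// => -[/candidatesP[q [c [s [y [w' [Fq [cq lc] ns [yq ly] [Ww ->]]]]]]] _].
have [lw' w'b] := IH s ns y w' ly Ww.
have [gs s1 s2] := next_timegrid gt tc ns.
split; first exact: vlatticeD.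
move=> j; have [_ q2] := FLplus_bounded f_bounded L_bounded Fq.
have := le_trans (row_norm_coord _ j) cq; rewrite !mxE ler_norml => /andP[_ h1].
have := le_trans (row_norm_coord _ j) q2; rewrite ler_norml => /andP[h2 _].
have := ler_wpM2l (ltW eps_gt0) h2; have := w'b j.
have : (s - t) * MbarL >= (eps - 2 * h) * MbarL by apply: ler_wpM2r => //; lra.
have := MbarL_dominates; lra.
Qed.

Lemma candidates_in_lattice_bounded t x w : timegrid T h t -> t < cut -> candidates t x w ->
  vlattice p h w /\ forall j, - (al + eps * ML) - ((T + h + h) * MbarL) - h <= w ord0 j.
Proof.
move=> gt tc /candidatesP[q [c [s [y [w' [Fq [cq lc] ns [yq ly] [Ww ->]]]]]]].
have [gs s1 s2] := next_timegrid gt tc ns.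
have [lw' w'b] := final_in_lattice_bounded gs ly Ww.
split; first exact: vlatticeD.
move=> j; have [_ q2] := FLplus_bounded f_bounded L_bounded Fq.
have := le_trans (row_norm_coord _ j) cq; rewrite !mxE ler_norml => /andP[_ h1].
have := le_trans (row_norm_coord _ j) q2; rewrite ler_norml => /andP[h2 _].
have := ler_wpM2l (ltW eps_gt0) h2; have := w'b j.
have /timegridP[_ hs _] := gs.
have : (T + h - s) * MbarL <= (T + h + h) * MbarL by apply: ler_wpM2r => //; lra.
lra.
Qed.

(** Every candidate value is above a value of W by a lattice vector; this replaces the
Pareto sets by the sets of all candidates. *)
Lemma candidate_dominated t x w : timegrid T h t -> vlattice n h x -> t < cut ->
  candidates t x w -> exists w', [/\ W t x w', vlattice p h (w - w') & orthant (w - w')].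
Proof.
move=> gt lx tc cw; rewrite final_step//.
apply: (@pareto_lattice_dominates _ _ h (candidates t x)
  (- (al + eps * ML) - ((T + h + h) * MbarL) - h)) => //.
  by move=> z /(candidates_in_lattice_bounded gt tc)[].
by move=> z /(candidates_in_lattice_bounded gt tc)[].
Qed.

Hypotheses (U_nonempty : U !=set0)
  (L_continuous : {within [set: 'rV[R]_n] `*` U,
     continuous (fun q : 'rV[R]_n * 'rV[R]_m => L q.1 q.2)})
  (f_lipschitz : forall x y u, U u -> `|f x u - f y u| <= Kf * `|x - y|)
  (L_lipschitz : forall x y u, U u -> `|L x u - L y u| <= KL * `|x - y|).

Notation Y := (Yset T U f L).

Let K_ge0 : 0 <= K. Proof. exact: ltW. Qed.
Let M_ge0 : 0 <= M. Proof. exact: le_trans M_ge1. Qed.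
Let fK x y u : U u -> `|f x u - f y u| <= K * `|x - y|.
Proof.
move=> Uu; apply: le_trans (f_lipschitz _ _ Uu) _.
by rewrite ler_wpM2r// /K le_max lexx.
Qed.
Let LK x y u : U u -> `|L x u - L y u| <= K * `|x - y|.
Proof.
move=> Uu; apply: le_trans (L_lipschitz _ _ Uu) _.
by rewrite ler_wpM2r// /K le_max lexx orbT.
Qed.

(** One step of the true trajectory is matched by one step of the scheme.  Rounding costs
at most h / 2 at either end of the step, for time, state and cost alike, and the drift of the
dynamics along the step costs eps K (h / 2 + M eps); together with the slack this stays
below alpha.  When the grid time is beyond the cut, the initial epigraph applies, and it contains
all lattice points within h of H. *)
Lemma grid_epigraph_contains_rounding th : timegrid T h th ->
  forall xh zh t x y z, vlattice n h xh -> vlattice p h zh -> 0 <= t -> t <= T ->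
    `|th - t| <= h / 2 -> `|xh - x| <= h / 2 -> `|zh - z| <= h / 2 ->
    Y t x y -> orthant (z - y) ->
  exists w, [/\ W th xh w, vlattice p h (zh - w) & orthant (zh - w)].
Proof.
have h2 : h / 2 <= h by have := h_gt0; lra.
move: th; apply: grid_time_ind => [th gt ct|th gt tc IH] xh zh t x y z lxh lzh t0 tT tth xxh zzh Yy oz.
  have : Hgrid T MbarL h (th, xh, zh).
    apply: (@in_Hgrid th t xh x zh z) => //.
    - move=> j; have := oz j; rewrite !mxE => ozj.
      have := le_trans (row_norm_coord y j) (Yset_bound (ltW Mf_gt0) ML_ge0 K_ge0 L_continuous f_bounded L_bounded LK t0 tT Yy).
      rewrite ler_norml => /andP[y1 _].
      have : (T - t) * ML <= (T - t) * MbarL.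
        by apply: ler_wpM2l; rewrite ?subr_ge0// ltW.
      lra.
    - exact: le_trans h2.
    - exact: le_trans h2.
    - exact: le_trans h2.
  rewrite -(V0_initial.2) => -[/= _ _ [w Vw [v [lv ov] <-]]].
  exists w; rewrite final_terminal//; rewrite addrC addKr; split => //.
have [h0 heps eps0] : [/\ 0 < h, 2 * h < eps - 2 * h & 0 < eps] by split.
move: tth; rewrite ler_norml => /andP[tth1 tth2].
have Me : eps <= M * eps by rewrite ler_peMl// ltW.
have te : t <= t + eps by lra.
have teT : t + eps <= T by rewrite /cut in tc; lra.
have [x' [c [y' [yE Yy' incr]]]] := Yset_split (ltW Mf_gt0) K_ge0 L_continuous f_bounded L_bounded fK LK t0 te teT Yy.
have tE : t + eps - t = eps by ring.
rewrite tE in incr.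
pose rho := h / 2 + M * eps.
have rhoP : `|x - xh| + Mf * eps <= rho.
  by rewrite distrC lerD// ler_wpM2r// ltW.
have [q [Fq q1 q2]] := incr xh rho h rhoP h0.
have alE : eps * (K * rho) + 2 * h <= al.
  rewrite alphaE /rho.
  have : 0 <= eps * (K * h) by rewrite !mulr_ge0// ltW.
  lra.
pose z' := y' + (z - y).
have [s ls sr] := lattice_round (t + eps) h0.
have [xs lxs xsr] := vlattice_round x' h0.
have [zs lzs zsr] := vlattice_round z' h0.
move: (sr); rewrite ler_norml => /andP[sr1 sr2].
have ns : next th s by split => //; rewrite /= in_itv/=; apply/andP; split; lra.
have te0 : 0 <= t + eps by lra.
have [|w' [Ww' lw' ow']] := IH s ns xs zs (t + eps) x' y' z' lxs lzs te0 teT sr xsr zsr Yy'.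
  by rewrite /z' addrC addKr.
have cw : candidates th xh ((zh - zs) + w').
  apply/candidatesP; exists q, (zh - zs), s, xs, w'; split => //.
    split; last exact: vlatticeB.
    have -> : eps *: q.2 - (zh - zs) = - (zh - z) - (c - eps *: q.2) - (z' - zs).
      by rewrite /z' yE; apply/rowP => j; rewrite !mxE; ring.
    apply: le_trans (ler_normB _ _) _; rewrite (distrC z').
    have := ler_normB (- (zh - z)) (c - eps *: q.2); rewrite normrN.
    lra.
  split => //.
  have -> : xh + eps *: q.1 - xs = (xh - x) - (x' - x - eps *: q.1) - (xs - x').
    by apply/rowP => j; rewrite !mxE; ring.
  apply: le_trans (ler_normB _ _) _.
  have := ler_normB (xh - x) (x' - x - eps *: q.1).
  lra.
have [w [Ww lw ow]] := candidate_dominated gt lxh tc cw.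
exists w; have -> : zh - w = (zh - zs + w' - w) + (zs - w').
  by apply/rowP => j; rewrite !mxE; ring.
by split => //; [exact: vlatticeD|exact: orthantD].
Qed.

Lemma FLplus_nonempty x : FLplus U f L x !=set0.
Proof.
have [u Uu] := U_nonempty; exists (f x u, L x u).
exact: hull_sub_FLplus (hull_gen Uu).
Qed.

(** Only times close to T are needed, for which one short piece reaches T. *)
Lemma Yset_nonempty t x : 0 <= t -> t <= T -> K * (T - t) <= 2^-1 -> Y t x !=set0.
Proof.
move=> t0 tT Kt; have [q Fq] := FLplus_nonempty x.
have Tt : 0 <= T - t by rewrite subr_ge0.
have tTE : t + (T - t) = T by rewrite addrC subrK.
have tT' : t + (T - t) <= T by rewrite tTE.
have [x' [_ _ h3]] := steerable_FLplus (ltW Mf_gt0) K_ge0 L_continuous f_bounded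
  L_bounded fK LK ltr01 Fq (r := `|x - x| + Mf * (T - t)) Tt t0 tT' Kt (lexx _).
rewrite tTE in h3.
have := Yset_final U_nonempty (ltW Mf_gt0) K_ge0 L_continuous f_bounded L_bounded LK x' (ltW T_gt0).
by move=> /h3[c [_ Yc]]; exists (c + 0).
Qed.

(** A chain of grid steps is shadowed by a true trajectory.  True times are grid times
shifted by the constant sigma, and a grid step of length theta is followed during exactly
theta.  The number kappa bounds the error of one step per unit of time, caused by alpha, by
theta differing from eps and by the drift; the number a - kappa / K bounds the current distance
of the states.  The bound a (exp (K (T - t)) - 1) solves the resulting Gronwall
recursion: a step multiplies a by 1 + K theta, adds theta K a to the cost, and
1 + K theta <= exp (K theta).  The last term accounts for the
remaining time, at most omega, when the chain has stopped or the next step would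
pass T. *)
Lemma Yset_shadows_grid (d kappa sigma omega : R) : 0 < d ->
  K * (M * (eps + 2 * h)) + d + (2 * h * M + al) / (eps - 2 * h) <= kappa ->
  K * omega <= 2^-1 -> M * eps + 2 * h + `|sigma| <= omega ->
  forall th, timegrid T h th ->
  forall xh w x a, vlattice n h xh -> W th xh w -> 0 <= th + sigma -> th + sigma <= T ->
    `|x - xh| + kappa / K <= a ->
  exists2 y, Y (th + sigma) x y &
    forall j, y ord0 j <= w ord0 j + a * (expR (K * (T - (th + sigma))) - 1)
       + (omega * ML + (omega + h + `|sigma|) * MbarL + h).
Proof.
move=> d0 kappaP Komega omegaP.
have [h0 heps eps0] : [/\ 0 < h, 2 * h < eps - 2 * h & 0 < eps] by split.
have Me : eps <= M * eps by rewrite ler_peMl// ltW.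
have sig1 := ler_norm sigma.
have sig2 : - sigma <= `|sigma| by rewrite -normrN ler_norm.
have sig0 := normr_ge0 sigma.
have e2 : 0 < eps - 2 * h by lra.
have kappa0 : 0 < kappa.
  apply: lt_le_trans kappaP.
  have : 0 <= K * (M * (eps + 2 * h)) by rewrite !mulr_ge0//; lra.
  have : 0 <= (2 * h * M + al) / (eps - 2 * h).
    by rewrite divr_ge0 ?ltW// addr_gt0 ?alpha_gt0// !mulr_gt0//; apply: lt_le_trans M_ge1.
  lra.
have terminal th xh w x a : timegrid T h th -> vlattice n h xh -> W th xh w ->
    0 <= th + sigma -> th + sigma <= T -> 0 <= a -> T - (th + sigma) <= omega ->
    exists2 y, Y (th + sigma) x y &
      forall j, y ord0 j <= w ord0 j + a * (expR (K * (T - (th + sigma))) - 1)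
       + (omega * ML + (omega + h + `|sigma|) * MbarL + h).
  move=> gt lxh Ww t0 tT a0 Tom.
  have [|y Yy] := @Yset_nonempty (th + sigma) x t0 tT.
    by apply: le_trans Komega; rewrite ler_wpM2l.
  exists y => // j.
  have := le_trans (row_norm_coord y j) (Yset_bound (ltW Mf_gt0) ML_ge0 K_ge0 L_continuous f_bounded L_bounded LK t0 tT Yy).
  rewrite ler_norml => /andP[_ y1].
  have [_ /(_ j) w1] := final_in_lattice_bounded gt lxh Ww.
  have : 0 <= a * (expR (K * (T - (th + sigma))) - 1).
    apply: mulr_ge0 => //; rewrite subr_ge0.
    have := expR_ge1Dx (K * (T - (th + sigma))).
    have : 0 <= K * (T - (th + sigma)) by rewrite mulr_ge0// subr_ge0.
    lra.
  have : (T - (th + sigma)) * ML <= omega * ML by apply: ler_wpM2r.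
  have : (T + h - th) * MbarL <= (omega + h + `|sigma|) * MbarL.
    by apply: ler_wpM2r => //; lra.
  lra.
apply: grid_time_ind => [th gt ct|th gt tc IH] xh w x a lxh Ww t0 tT xa.
  apply: terminal => //; last by rewrite /cut in ct; lra.
  by apply: le_trans xa; rewrite addr_ge0// divr_ge0 ?ltW.
have a0 : 0 <= a by apply: le_trans xa; rewrite addr_ge0// divr_ge0 ?ltW.
have := Ww; rewrite final_step// => -[/candidatesP[q [c [s [xs [w' [Fq [cq lc] ns [xsq lxs] [Ww' wE]]]]]]] _].
have [gs s1 s2] := next_timegrid gt tc ns.
pose theta := s - th.
have th1 : eps - 2 * h <= theta by rewrite /theta; lra.
have th2 : theta <= eps + 2 * h by rewrite /theta; lra.
have [Tth|thT] := ltP (T - (th + sigma)) theta.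
  by apply: terminal => //; lra.
have th0 : 0 <= theta by lra.
have sE : th + sigma + theta = s + sigma by rewrite /theta; ring.
have sT : th + sigma + theta <= T by lra.
pose b := `|x - xh|.
have b0 : 0 <= b by exact: normr_ge0.
have Kth : K * theta <= 2^-1.
  by apply: le_trans Komega; rewrite ler_wpM2l//; lra.
have [x' [x'1 x'2 x'3]] := steerable_FLplus (ltW Mf_gt0) K_ge0 L_continuous f_bounded
  L_bounded fK LK d0 Fq (r := b + Mf * theta) th0 t0 sT Kth (lexx _).
rewrite sE in x'3.
(* This is the error of one step, with a bound that is linear in theta. *)
have err : theta * (K * (b + Mf * theta) + d) + 2 * h * M + al <= theta * (K * b + kappa).
  have e1 : Mf * theta <= M * (eps + 2 * h).
    apply: (@le_trans _ _ (M * theta)); first by rewrite ler_wpM2r.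
    by rewrite ler_wpM2l.
  have e3 : 2 * h * M + al <= theta * ((2 * h * M + al) / (eps - 2 * h)).
    rewrite mulrA ler_pdivlMr// mulrC ler_wpM2r//.
    by rewrite addr_ge0 ?(ltW alpha_gt0)// !mulr_ge0// ltW.
  have := ler_wpM2l th0 (ler_wpM2l K_ge0 e1).
  have := ler_wpM2l th0 kappaP.
  lra.
have [qM1 qM2] := FLplus_bounded f_bounded L_bounded Fq.
have the : `|theta - eps| <= 2 * h by rewrite ler_norml; apply/andP; split; lra.
have theq (V : normedModType R) (v : V) : `|v| <= M -> `|(theta - eps) *: v| <= 2 * h * M.
  by move=> vM; rewrite normrZ; apply: ler_pM.
have sT' : s + sigma <= T by rewrite -sE.
have s0' : 0 <= s + sigma by rewrite -sE; lra.
have xs' : `|x' - xs| + kappa / K <= a * (1 + K * theta).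
  have -> : x' - xs = (x' - x - theta *: q.1) + (x - xh) + (theta - eps) *: q.1 + (xh + eps *: q.1 - xs).
    by apply/rowP => j; rewrite !mxE; ring.
  have n1 := ler_normD (x' - x - theta *: q.1 + (x - xh) + (theta - eps) *: q.1) (xh + eps *: q.1 - xs).
  have n2 := ler_normD (x' - x - theta *: q.1 + (x - xh)) ((theta - eps) *: q.1).
  have n3 := ler_normD (x' - x - theta *: q.1) (x - xh).
  have n4 := theq _ q.1 (le_trans qM1 Mf_le).
  rewrite -/b in n3.
  have Kth0 : 0 <= 1 + K * theta by rewrite addr_ge0// mulr_ge0.
  have := ler_wpM2r Kth0 xa; rewrite -/b.
  have -> : (b + kappa / K) * (1 + K * theta) = b + theta * (K * b + kappa) + kappa / K.
    by field; rewrite gt_eqF.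
  lra.
have [y' Yy' y'P] := IH s ns xs w' x' _ lxs Ww' s0' sT' xs'.
have [c' [c'1 Yc']] := x'3 y' Yy'.
exists (c' + y') => // j.
have n1 := le_trans (row_norm_coord _ j) c'1.
have n2 := le_trans (row_norm_coord _ j) cq.
have n3 := le_trans (row_norm_coord _ j) (theq _ q.2 (le_trans qM2 ML_le)).
rewrite !mxE in n1 n2 n3.
move: n1; rewrite ler_norml => /andP[_ n1].
move: n2; rewrite ler_norml => /andP[_ n2].
move: n3; rewrite ler_norml => /andP[_ n3].
have ka : theta * (K * b + kappa) <= theta * (K * a).
  apply: ler_wpM2l => //; have := ler_wpM2l K_ge0 xa.
  by rewrite mulrDr mulrCA divff ?mulr1 ?gt_eqF.
have ex : (1 + K * theta) * expR (K * (T - (s + sigma))) <= expR (K * (T - (th + sigma))).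
  have -> : K * (T - (th + sigma)) = K * theta + K * (T - (s + sigma)) by rewrite -sE; ring.
  by rewrite expRD ler_wpM2r ?expR_ge0// expR_ge1Dx.
have := ler_wpM2l a0 ex.
have := y'P j; rewrite wE !mxE.
lra.
Qed.

End Discrete.

(** * Painleve-Kuratowski limits *)

Section PKCriterion.
Context {R : realType} {X : pseudoMetricType R}.
Variables (P : set (R * R)) (D : R * R -> set X).
Hypothesis P_fine : arbitrarily_fine P.

Lemma fine_pairs_filter : Filter (@fine_pairs R).
Proof.
apply: filter_from_filter; first by exists 1; exact: ltr01.
move=> d e d0 e0; exists (Num.min d e); first by rewrite /= lt_min d0.
by move=> q /= []; rewrite !lt_min => /and3P[-> -> ->] /and3P[-> -> ->].
Qed.

Lemma within_fine_pairsP (S : set (R * R)) : within P fine_pairs S <->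
  exists2 d, 0 < d & forall q, P q -> 0 < q.1 < d -> 0 < q.2 / q.1 < d -> S q.
Proof.
split; first by move=> [d d0 dS]; exists d => // q Pq q1 q2; apply: dS.
by move=> [d d0 dS]; exists d => // q [q1 q2] Pq; exact: dS.
Qed.

Lemma edist_inf_le q y a (e : R) : 0 < e -> D q a -> ball y e a ->
  (edist_inf (D q) y <= e%:E)%E.
Proof.
move=> e0 Da ya; apply: le_trans (edist_fin (xy := (y, a)) e0 ya).
by apply: ereal_inf_lbound; exists a.
Qed.

Lemma edist_inf_lt q y (e : R) : (edist_inf (D q) y < e%:E)%E ->
  exists a, D q a /\ ball y e a.
Proof.
by move=> /ereal_inf_lt[_ [a Da <-] /edist_lt_ball ya]; exists a.
Qed.

(** The lower limit is contained in the upper one as soon as there are arbitrarily fine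
pairs, so it is enough to place A below the former and above the latter, and both
conditions can be stated with balls instead of distances. *)
Lemma PK_limitP (A : set X) :
  (forall y, A y -> forall e, 0 < e -> exists2 d, 0 < d &
     forall q, P q -> 0 < q.1 < d -> 0 < q.2 / q.1 < d -> exists a, D q a /\ ball y e a) ->
  (forall y, (forall e d, 0 < e -> 0 < d -> exists q, [/\ P q, 0 < q.1 < d,
     0 < q.2 / q.1 < d & exists a, D q a /\ ball y e a]) -> A y) ->
  PK_limit (within P fine_pairs) D A.
Proof.
move=> lowA uppA; have Ffine := fine_pairs_filter.
have A_low : A `<=` lower_limit (within P fine_pairs) D.
  move=> y Ay; rewrite /lower_limit /=; apply/fine_cvgP.
  have close e : 0 < e -> \forall q \near within P fine_pairs,
      (edist_inf (D q) y <= e%:E)%E.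
    move=> e0; apply/within_fine_pairsP; have [d d0 dq] := lowA y Ay e e0.
    by exists d => // q Pq q1 q2; have [a [Da ya]] := dq q Pq q1 q2; exact: edist_inf_le ya.
  split.
    apply: filterS (close 1 ltr01) => q h.
    by rewrite ge0_fin_numE ?edist_inf_ge0//; apply: le_lt_trans h _; exact: ltry.
  apply/cvgrPdist_le => e e0; apply: filterS (close e e0) => q h.
  have fin : edist_inf (D q) y \is a fin_num.
    by rewrite ge0_fin_numE ?edist_inf_ge0//; apply: le_lt_trans h _; exact: ltry.
  by rewrite sub0r normrN ger0_norm ?fine_ge0 ?edist_inf_ge0//= -lee_fin fineK.
have low_upp : lower_limit (within P fine_pairs) D `<=` upper_limit (within P fine_pairs) D.
  move=> y; rewrite /lower_limit /upper_limit /= => cv.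
  rewrite limf_einfE; apply/eqP; rewrite eq_le; apply/andP; split.
    apply: ge_ereal_sup => _ [S FS <-]; apply/lee_addgt0Pr => e e0; rewrite add0e.
    have FE : within P fine_pairs [set q | (edist_inf (D q) y < e%:E)%E].
      exact: (cv _ (@nbhs_open_ereal_lt _ 0 (fun=> e) e0)).
    have [d d0 dq] := (within_fine_pairsP _).1 (filterI FS FE).
    have [q Pq [q1 q2]] := P_fine d0.
    have [Sq qe] := dq q Pq q1 q2.
    by apply: le_trans (ltW qe); apply: ereal_inf_lbound; exists q.
  apply: (@le_trans _ _ (ereal_inf ((fun q => edist_inf (D q) y) @` setT))).
    by apply: le_ereal_inf_tmp => _ [q _ <-]; exact: edist_inf_ge0.
  by apply: ereal_sup_ubound; exists setT => //; exact: filterT.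
have upp_A : upper_limit (within P fine_pairs) D `<=` A.
  move=> y; rewrite /upper_limit /= limf_einfE => lim0; apply: uppA => e d e0 d0.
  pose S := [set q : R * R | [/\ P q, 0 < q.1 < d & 0 < q.2 / q.1 < d]].
  have FS : within P fine_pairs S by apply/within_fine_pairsP; exists d.
  have : (ereal_inf ((fun q => edist_inf (D q) y) @` S) < e%:E)%E.
    apply: (@le_lt_trans _ _ 0%E); last by rewrite lte_fin.
    by rewrite -lim0; apply: ereal_sup_ubound; exists S.
  move=> /ereal_inf_lt[_ [q [Pq q1 q2] <-] /edist_inf_lt qe].
  by exists q.
split; apply/seteqP; split => //.
- by move=> y /low_upp /upp_A.
- by move=> y /A_low /low_upp.
Qed.

End PKCriterion.

(** * Convergence of the epigraphs *)

Lemma bounded_closure_compact (R : realType) (p : nat) (S : set 'rV[R]_p) (B : R) :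
  (forall y, S y -> `|y| <= B) -> compact (closure S).
Proof.
move=> SB; apply: bounded_closed_compact; last exact: closed_closure.
exists B; split; first exact: num_real.
move=> B' BB' y cSy /=; apply: le_trans (ltW BB'); apply/ler_addgt0Pr => e e0.
have [y' [Sy' yy']] := cSy _ (nbhsx_ballx y e e0).
rewrite mx_norm_ball /ball_/= in yy'.
have := ler_normD (y - y') y'; rewrite subrK; have := SB y' Sy'; lra.
Qed.

(** The approximate solutions for smaller and smaller e form a filter, which has a cluster point
in the compact closure. *)
Lemma closure_attains_approximate_bound (R : realType) (p : nat) (S : set 'rV[R]_p)
  (z : 'rV[R]_p) : compact (closure S) ->
  (forall e, 0 < e -> exists2 y, S y & forall j, y ord0 j <= z ord0 j + e) ->
  exists v, closure S v /\ orthant (z - v).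
Proof.
move=> cS Sz; pose A (e : R) := [set y : 'rV[R]_p | S y /\ forall j, y ord0 j <= z ord0 j + e].
pose F : set_system 'rV[R]_p := filter_from [set e : R | 0 < e] A.
have FF : Filter F.
  apply: filter_from_filter; first by exists 1; exact: ltr01.
  move=> d e d0 e0; exists (Num.min d e); first by rewrite /= lt_min d0.
  move=> y [Sy yz]; have [m1 m2] : Num.min d e <= d /\ Num.min d e <= e.
    by rewrite !ge_min !lexx orbT.
  by split; split => // j; have := yz j; lra.
have PF : ProperFilter F.
  by apply: filter_from_proper => // e /Sz[y Sy yz]; exists y.
have FS : F (closure S).
  by exists 1; [exact: ltr01|move=> y [Sy _]; exact: subset_closure].
have [v [cSv clv]] := cS F PF FS; exists v; split => // j.
rewrite !mxE subr_ge0; apply/ler_addgt0Pr => e e0.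
have e2 : 0 < e / 2 by rewrite divr_gt0.
have FA : F (A (e / 2)) by exists (e / 2).
have [y [[_ yz] vy]] := clv _ _ FA (nbhsx_ballx v _ e2).
rewrite mx_norm_ball /ball_/= in vy.
have := le_lt_trans (row_norm_coord (v - y) j) vy; rewrite !mxE ltr_norml => /andP[_ h].
have := yz j; lra.
Qed.

Section Convergence.
Context {R : realType} {n m p : nat}.
Variables (T : R) (U : set 'rV[R]_m).
Variables (f : 'rV[R]_n -> 'rV[R]_m -> 'rV[R]_n)
          (L : 'rV[R]_n -> 'rV[R]_m -> 'rV[R]_p).
Variables (Mf ML Kf KL MbarL : R).
Hypotheses (T_gt0 : 0 < T) (U_nonempty : U !=set0)
  (Mf_gt0 : 0 < Mf) (ML_ge0 : 0 <= ML) (Kf_gt0 : 0 < Kf) (KL_ge0 : 0 <= KL)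
  (L_continuous : {within [set: 'rV[R]_n] `*` U,
     continuous (fun q : 'rV[R]_n * 'rV[R]_m => L q.1 q.2)})
  (f_bounded : forall x u, U u -> `|f x u| <= Mf)
  (L_bounded : forall x u, U u -> `|L x u| <= ML)
  (f_lipschitz : forall x y u, U u -> `|f x u - f y u| <= Kf * `|x - y|)
  (L_lipschitz : forall x y u, U u -> `|L x u - L y u| <= KL * `|x - y|)
  (MbarL_gt : ML < MbarL).
Variables (V0 : R -> R -> R -> 'rV[R]_n -> set 'rV[R]_p).
Hypothesis (V0_initial : forall eps h : R, 0 < eps -> 0 < h ->
     initial_map T MbarL h (V0 eps h)).

Notation pairs := (considered T Mf ML Kf KL MbarL V0).
Notation Dq := (fun q => grid_epigraph T q.2
       (final_approx T U f L Mf ML Kf KL V0 q.1 q.2)).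
Notation Y := (Yset T U f L).

Let M := Num.max 1 (Num.max Mf ML).
Let K := Num.max Kf KL.
Let M_ge1 : 1 <= M. Proof. by rewrite /M le_max lexx. Qed.
Let K_gt0 : 0 < K. Proof. by rewrite /K lt_max Kf_gt0. Qed.

Lemma rounded_epigraph_close t x y z (e : R) : 0 <= t -> t <= T -> Y t x y -> orthant (z - y) ->
  0 < e -> exists2 d, 0 < d &
    forall q, pairs q -> 0 < q.1 < d -> 0 < q.2 / q.1 < d ->
      exists a, Dq q a /\ ball (t, x, z) e a.
Proof.
move=> t0 tT Yy oz e0.
exists (Num.min 1 e); first by rewrite lt_min ltr01.
move=> [eps h] [[eps0 h0] _ heps _ dom] /= /andP[_ ed] /andP[_].
rewrite /= in eps0 h0 heps dom.
rewrite ltr_pdivrMr// => hd.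
have he : h < e.
  have [d1 d2] : Num.min 1 e <= 1 /\ Num.min 1 e <= e by rewrite !ge_min !lexx orbT.
  apply: lt_le_trans hd _; apply: (@le_trans _ _ (Num.min 1 e * 1)); last by rewrite mulr1.
  by rewrite ler_wpM2l ?le_min ?ler01 ?ltW//; lra.
have he2 : h / 2 < e by lra.
have [th lth thr] := lattice_round t h0.
have [xh lxh xhr] := vlattice_round x h0.
have [zh lzh zhr] := vlattice_round z h0.
have gt : timegrid T h th.
  apply/timegridP => //; move: thr; rewrite ler_norml => /andP[h1 h2].
  by split => //; lra.
have [w [Ww lw ow]] := grid_epigraph_contains_rounding T_gt0 Mf_gt0 ML_ge0 Kf_gt0 MbarL_gt
  f_bounded L_bounded eps0 h0 heps (V0_initial eps0 h0) dom L_continuous f_lipschitz L_lipschitz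
  gt lxh lzh t0 tT thr xhr zhr Yy oz.
exists (th, xh, zh); split.
  split => //=; exists w => //; exists (zh - w); first by split.
  by rewrite addrC subrK.
split; first split => /=.
- by rewrite /ball/= distrC; exact: le_lt_trans he2.
- by rewrite mx_norm_ball /ball_/= distrC; exact: le_lt_trans he2.
- by rewrite mx_norm_ball /ball_/= distrC; exact: le_lt_trans he2.
Qed.

(** All errors in the shadowing estimate are at most a constant times d when eps < d,
h / eps < d and the grid point is within d of (t, x, z).  The constant C1 is for the local
error rate kappa: alpha / eps is of order h / eps + eps.  The constant C is for the total
error, including the distances to the grid point. *)
Lemma Yset_below_limit t x z :
  (forall e d, 0 < e -> 0 < d -> exists q, [/\ pairs q, 0 < q.1 < d,
     0 < q.2 / q.1 < d & exists a, Dq q a /\ ball (t, x, z) e a]) ->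
  [/\ 0 <= t, t <= T & forall e, 0 < e -> exists2 y, Y t x y & forall j, y ord0 j <= z ord0 j + e].
Proof.
move=> lim.
have near_grid e : 0 < e -> - e <= t <= T + e.
  move=> e0; have e2 : 0 < Num.min 1 (e / 2) by rewrite lt_min ltr01 divr_gt0.
  have [m1 m2] : Num.min 1 (e / 2) <= 1 /\ Num.min 1 (e / 2) <= e / 2.
    by rewrite !ge_min !lexx orbT.
  have [[eps h] [[[eps0 h0] _ _ _ _] /= /andP[_ ed] /andP[_]]] := lim _ _ e2 e2.
  rewrite /= in eps0 h0; rewrite ltr_pdivrMr// => hd [[[th xh] zh] [[/= gt _ _] [[/= bt _] _]]].
  have /(timegridP T_gt0 h0)[_ t1 t2] := gt.
  have he : h <= e / 2.
    apply: le_trans (ltW hd) _; apply: (@le_trans _ _ (Num.min 1 (e / 2) * 1)).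
      by rewrite ler_wpM2l; lra.
    by rewrite mulr1.
  move: bt; rewrite /ball/= ltr_norml => /andP[b1 b2].
  by apply/andP; split; lra.
have t0 : 0 <= t.
  apply/ler_addgt0Pr => e e0; have /andP[h _] := near_grid e e0; lra.
have tT : t <= T.
  by apply/ler_addgt0Pr => e e0; have /andP[_ h] := near_grid e e0.
split => // e e0.
pose E := expR (K * (T - t)) - 1.
have E0 : 0 <= E.
  rewrite subr_ge0 (le_trans _ (expR_ge1Dx _))// lerDl mulr_ge0 ?subr_ge0// ltW//.
pose C1 := 2 * K * M + 4 * M + 5 + 2 * K + 2 * K * M.
have KM0 : 0 <= K * M by rewrite mulr_ge0 ?ltW// (lt_le_trans ltr01).
have K0 := ltW K_gt0.
have C10 : 0 <= C1 by rewrite /C1; have := M_ge1; lra.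
pose C := (1 + C1 / K) * E + (M + 3) * ML + (M + 5) * MbarL + 2.
have MbarL0 : 0 <= MbarL by rewrite (le_trans ML_ge0)// ltW.
have M0 : 0 <= M by exact: le_trans M_ge1.
have C0 : 0 <= C.
  have h1 : 0 <= (1 + C1 / K) * E by rewrite mulr_ge0// addr_ge0// divr_ge0.
  have h2 : 0 <= (M + 3) * ML by rewrite mulr_ge0//; lra.
  have h3 : 0 <= (M + 5) * MbarL by rewrite mulr_ge0//; lra.
  by rewrite /C; lra.
pose d := Num.min (8^-1) (Num.min ((2 * (K * (M + 3)))^-1) (e / (C + 1))).
have KM3 : 0 < K * (M + 3) by rewrite mulr_gt0//; lra.
have d0 : 0 < d.
  by rewrite /d !lt_min invr_gt0 ltr0n/= invr_gt0 mulr_gt0//= divr_gt0//; lra.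
have [d1 d2 d3] : [/\ d <= 8^-1, d <= (2 * (K * (M + 3)))^-1 & d <= e / (C + 1)].
  by rewrite /d !ge_min !lexx !orbT.
have Cd : C * d <= e by rewrite ler_pdivlMr in d3; lra.
have [[eps h] [[[eps0 h0] _ heps _ dom] /= /andP[_ ed] /andP[_]]] := lim _ _ d0 d0.
rewrite /= in eps0 h0 heps dom; rewrite ltr_pdivrMr// => hd [[[th xh] zh] [[/= gt lxh [w Ww [v [lv ov] wv]]] [[/= bt bx] bz]]].
pose sigma := t - th.
have tE : th + sigma = t by rewrite /sigma addrC subrK.
have sig : `|sigma| <= d by exact: ltW.
have hd1 : h <= d.
  apply: le_trans (ltW hd) _; apply: (@le_trans _ _ (d * 1)); last by rewrite mulr1.
  by rewrite ler_wpM2l// ?ltW//; lra.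
have h8 : h <= eps / 8.
  apply: le_trans (ltW hd) _; rewrite mulrC ler_wpM2l// ltW//.
have omega_K : K * ((M + 3) * d) <= 2^-1.
  rewrite mulrA -ler_pdivlMl//; apply: le_trans d2 _.
  by rewrite invfM mulrC.
have omega_sig : M * eps + 2 * h + `|sigma| <= (M + 3) * d.
  have := ler_wpM2l M0 (ltW ed); lra.
have step0 : 0 < eps - 2 * h by lra.
have kappaP : K * (M * (eps + 2 * h)) + d + (2 * h * M + alpha Mf ML Kf KL eps h) / (eps - 2 * h)
   <= C1 * d.
  have k1 : K * (M * (eps + 2 * h)) <= K * M * (2 * d).
    by rewrite mulrA ler_wpM2l//; lra.
  have k2 : (2 * h * M + alpha Mf ML Kf KL eps h) / (eps - 2 * h) <=
     (4 * M + 4 + 2 * K + 2 * (K * M)) * d.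
    rewrite ler_pdivrMr// alphaE -/M -/K.
    have e1 : eps <= 2 * (eps - 2 * h) by lra.
    have e2 := ler_wpM2l (ltW d0) e1.
    have e3 : h * M <= d * eps * M by rewrite ler_wpM2r// ltW.
    have e4 := ler_wpM2r M0 e2.
    have e5 : eps * h * K <= d * eps * K by rewrite (mulrC eps h) ler_wpM2r// ler_wpM2r// ltW.
    have e6 := ler_wpM2r K0 e2.
    have e7 : eps ^+ 2 * K * M <= d * eps * (K * M).
      by rewrite -mulrA expr2 ler_wpM2r// ler_wpM2r// ltW.
    have e8 := ler_wpM2r KM0 e2.
    lra.
  by rewrite /C1; lra.
have xxh : `|x - xh| + C1 * d / K <= d * (1 + C1 / K).
  rewrite mulrDr mulr1 mulrA (mulrC d); apply: lerD => //.
  by move: bx; rewrite mx_norm_ball => /ltW.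
have [||y Yy yP] := Yset_shadows_grid T_gt0 Mf_gt0 ML_ge0 Kf_gt0 MbarL_gt f_bounded L_bounded
  eps0 h0 heps (V0_initial eps0 h0) dom U_nonempty L_continuous f_lipschitz L_lipschitz d0
  kappaP omega_K omega_sig gt lxh Ww _ _ xxh.
- by rewrite tE.
- by rewrite tE.
rewrite tE in Yy yP; exists y => // j.
have := yP j; rewrite -/E.
have wz : w ord0 j <= z ord0 j + d.
  have vj := ov j.
  move: bz; rewrite mx_norm_ball => /= /ltW bz.
  have := le_trans (row_norm_coord _ j) bz; rewrite -wv !mxE ler_norml => /andP[b1 b2]; lra.
have o1 : ((M + 3) * d + h + `|sigma|) * MbarL <= ((M + 5) * d) * MbarL.
  by apply: ler_wpM2r => //; lra.
move: Cd; rewrite /C; lra.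
Qed.

Lemma Yset_closure_compact t x : 0 <= t -> t <= T -> compact (closure (Y t x)).
Proof.
move=> t0 tT; apply: (@bounded_closure_compact _ _ _ ((T - t) * ML)) => y.
apply: (Yset_bound (ltW Mf_gt0) ML_ge0 KL_ge0 L_continuous f_bounded L_bounded L_lipschitz t0 tT).
Qed.

End Convergence.

Theorem corollary6p4 (R : realType) (n m p : nat)
  (T : R) (T_gt0 : 0 < T)
  (U : set 'rV[R]_m) (U_nonempty : U !=set0) (U_compact : compact U)
  (f : 'rV[R]_n -> 'rV[R]_m -> 'rV[R]_n)
  (L : 'rV[R]_n -> 'rV[R]_m -> 'rV[R]_p)
  (Mf ML Kf KL : R)
  (Mf_gt0 : 0 < Mf) (ML_ge0 : 0 <= ML) (Kf_gt0 : 0 < Kf) (KL_ge0 : 0 <= KL)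
  (f_continuous : {within [set: 'rV[R]_n] `*` U,
     continuous (fun q : 'rV[R]_n * 'rV[R]_m => f q.1 q.2)})
  (L_continuous : {within [set: 'rV[R]_n] `*` U,
     continuous (fun q : 'rV[R]_n * 'rV[R]_m => L q.1 q.2)})
  (f_bounded : forall x u, U u -> `|f x u| <= Mf)
  (L_bounded : forall x u, U u -> `|L x u| <= ML)
  (f_lipschitz : forall x y u, U u -> `|f x u - f y u| <= Kf * `|x - y|)
  (L_lipschitz : forall x y u, U u -> `|L x u - L y u| <= KL * `|x - y|)
  (MbarL : R) (MbarL_gt : ML < MbarL)
  (V0 : R -> R -> R -> 'rV[R]_n -> set 'rV[R]_p)
  (V0_initial : forall eps h : R, 0 < eps -> 0 < h ->
     initial_map T MbarL h (V0 eps h))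
  (pairs := considered T Mf ML Kf KL MbarL V0)
  (pairs_fine : arbitrarily_fine pairs) :
  PK_limit (within pairs fine_pairs)
    (fun q => grid_epigraph T q.2
       (final_approx T U f L Mf ML Kf KL V0 q.1 q.2))
    (epigraph `[0, T] [set: 'rV[R]_n] orthant (return_map T U f L)).
Proof.
apply: PK_limitP => // [[[t x] z] [/= tT _ [v [cYv _] [u ou <-]]] e e0|[[t x] z] lim].
  have /andP[t0 tleT] : 0 <= t <= T by move: tT; rewrite in_itv.
  have e2 : 0 < e / 2 by rewrite divr_gt0.
  have [y [Yy vy]] := cYv _ (nbhsx_ballx v _ e2).
  have oyu : orthant (y + u - y) by rewrite addrAC subrr add0r.
  have [d d0 dP] := rounded_epigraph_close T_gt0 Mf_gt0 ML_ge0 Kf_gt0 L_continuous f_bounded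
    L_bounded f_lipschitz L_lipschitz MbarL_gt V0_initial t0 tleT Yy oyu e2.
  exists d => // q Pq q1 q2; have [[[t' x'] z'] [Da [[/= bt bx] bz]]] := dP q Pq q1 q2.
  exists (t', x', z'); split => //; split; first split => /=.
  - by apply: le_ball bt; lra.
  - by apply: le_ball bx; lra.
  - rewrite [e]splitr; apply: ball_triangle bz.
    move: vy; rewrite !mx_norm_ball /ball_/= => vy.
    by have -> : v + u - (y + u) = v - y by rewrite opprD addrACA subrr addr0.
have [t0 tT Ylim] := Yset_below_limit T_gt0 U_nonempty Mf_gt0 ML_ge0 Kf_gt0 L_continuous f_bounded
    L_bounded f_lipschitz L_lipschitz MbarL_gt V0_initial lim.
have cY := Yset_closure_compact Mf_gt0 ML_ge0 KL_ge0 L_continuous f_bounded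
    L_bounded L_lipschitz (x := x) t0 tT.
have [v [cYv ov]] := closure_attains_approximate_bound cY Ylim.
have [w [pw ow]] := pareto_compact_dominates cY cYv.
split => //=; first by rewrite in_itv/= t0.
exists w => //; exists (z - w); last by rewrite addrC subrK.
by have -> : z - w = (z - v) + (v - w); [rewrite subrKA|exact: orthantD].
Qed.
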